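(* Let $\alpha\in\mathbb{C}$ with $\alpha\notin\mathbb{Z}$ and $\mathrm{Re}\,\alpha>-1/2$, and let $\phi(e^{i\theta})=u_\alpha(e^{i(\theta-\pi)})=(2+2\cos\theta)^\alpha$, where $u_\alpha(e^{i\theta})=(2-2\cos\theta)^\alpha$. Then, as $n\to\infty$, $$\det M_n(\phi)\sim n^{(\alpha^2+\alpha)/2}\,(2\pi)^{-\alpha/2}\,2^{3\alpha^2/2}\,\frac{G(1/2+\alpha)\,G(1+\alpha)^2}{G(1/2)\,G(1+2\alpha)}.$$
   Context: $\phi_k=\frac1{2\pi}\int_0^{2\pi}\phi(e^{i\theta})e^{-ik\theta}d\theta$ is the $k$-th Fourier coefficient, and $M_n(\phi)=(\phi_{j-k}+\phi_{j+k+1})_{j,k=0}^{n-1}$. $G(\cdot)$ is the Barnes G-function, $G(1+z)=(2\pi)^{z/2}e^{-(z+1)z/2-\gamma_E z^2/2}\prod_{k=1}^\infty\left((1+z/k)^k e^{-z+z^2/(2k)}\right)$, with $\gamma_E$ Euler's constant. $a_n\sim c_n$ means $a_n=c_n(1+o(1))$ as $n\to\infty$. *)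

(* Defs.v *)
From HB Require Import structures.
From mathcomp Require Import all_boot all_order all_algebra.
From mathcomp Require Import all_classical all_reals all_analysis.
From mathcomp Require Import complex.

Set Implicit Arguments.
Unset Strict Implicit.
Unset Printing Implicit Defensive.

Import Order.TTheory GRing.Theory Num.Theory.
Import numFieldNormedType.Exports.

Local Open Scope classical_set_scope.
Local Open Scope ring_scope.
Local Open Scope complex_scope.

Definition cexp (R : realType) (z : R[i]) : R[i] :=
  (expR (complex.Re z))%:C * (cos (complex.Im z) +i* sin (complex.Im z)).

Definition cis (R : realType) (t : R) : R[i] := cexp ('i * t%:C).

(* x ^ a for a real base x >= 0 and a complex exponent a; the value at x = 0
   follows the convention of powR. *)
Definition cpow (R : realType) (x : R) (a : R[i]) : R[i] :=
  if x == 0 then (a == 0)%:R else cexp (a * (ln x)%:C).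

(* On the unit circle, Re (e^{i t}) = cos t: see u_symbol_cis below. *)
Definition u_symbol (R : realType) (alpha z : R[i]) : R[i] :=
  cpow (2 - 2 * complex.Re z) alpha.

Definition cintegral (R : realType) (a b : R) (f : R -> R[i]) : R[i] :=
  (\int[lebesgue_measure]_(t in `[a, b]) complex.Re (f t))%R +i*
  (\int[lebesgue_measure]_(t in `[a, b]) complex.Im (f t))%R.

Definition fourier_coef (R : realType) (phi : R[i] -> R[i]) (k : int) : R[i] :=
  (1 / (2 * pi))%:C *
  cintegral 0 (2 * pi) (fun t => phi (cis t) * cexp (- ('i * k%:~R * t%:C))).

Definition toeplitz_hankel (R : realType) (phi : R[i] -> R[i]) (n : nat) :
    'M[R[i]]_n :=
  \matrix_(j < n, k < n)
    (fourier_coef phi (j%:Z - k%:Z) + fourier_coef phi (j%:Z + k%:Z + 1)).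

Definition euler_gamma (R : realType) : R :=
  limn (fun n : nat => (\sum_(1 <= k < n.+1) (k%:R)^-1) - ln n%:R).

(* The defining product formula gives G (1 + z), whence z := w - 1; R[i]^o
   carries the topology of the modulus. *)
Definition barnesG (R : realType) (w : R[i]) : R[i] :=
  let z := w - 1 in
  cpow (2 * pi) (z / 2) *
  cexp (- ((z + 1) * z / 2) - (euler_gamma R)%:C * z ^+ 2 / 2) *
  limn (fun n : nat => \prod_(1 <= k < n.+1)
          ((1 + z / k%:R) ^+ k * cexp (- z + z ^+ 2 / (2 * k%:R))) : R[i]^o).

(* a n = c n * (1 + o(1)); the identity is only required eventually. *)
Definition asymp_equiv (R : realType) (a c : nat -> R[i]) : Prop :=
  exists2 e : nat -> R[i]^o, e @ \oo --> (0 : R[i]^o) &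
    \forall n \near \oo, a n = c n * (1 + e n).

Lemma asymp_equivP (R : realType) (a c : nat -> R[i]) :
  asymp_equiv a c <-> (a : nat -> R[i]^o) ~_\oo (c : nat -> R[i]^o).
Proof.
split=> [[e /cvgrPdist_le e0 ace]|/eqaddoP ac].
  apply/eqaddoP => eps eps0.
  near=> n.
  rewrite [X in `|X|](_ : _ = a n - c n)//.
  have -> : a n = c n * (1 + e n) by near: n.
  rewrite mulrDr mulr1 addrAC subrr add0r normrM mulrC ler_wpM2r//.
  by rewrite -normrN -[X in `|X|]add0r; near: n; exact: e0.
pose e n : R[i]^o := if c n == 0 then 0 else a n / c n - 1.
exists e.
  apply/cvgrPdist_le => eps eps0; near=> n.
  rewrite sub0r normrN /e; case: ifPn => [_|c0]; first by rewrite normr0 ltW.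
  have -> : a n / c n - 1 = (a n - c n) / c n by rewrite mulrBl divff.
  rewrite normrM normfV ler_pdivrMr ?normr_gt0//.
  by near: n; exact: ac.
near=> n; rewrite /e; case: ifPn => [/eqP c0|c0].
  have : `|a n - c n| <= 1 * `|c n| by near: n; exact: ac.
  by rewrite c0 normr0 mulr0 subr0 normr_le0 mul0r => /eqP.
by rewrite addrC subrK mulrC divfK.
Unshelve. all: by end_near. Qed.

Lemma cisE (R : realType) (t : R) : cis t = cos t +i* sin t.
Proof.
by rewrite /cis /cexp /= !mul0r !mul1r subrr add0r expR0 mul1r.
Qed.

Lemma u_symbol_cis (R : realType) (alpha : R[i]) (t : R) :
  u_symbol alpha (cis t) = cpow (2 - 2 * cos t) alpha.
Proof. by rewrite /u_symbol cisE. Qed.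

Lemma u_symbol_cisBpi (R : realType) (alpha : R[i]) (t : R) :
  u_symbol alpha (cis (t - pi)) = cpow (2 + 2 * cos t) alpha.
Proof. by rewrite u_symbol_cis cosB cospi sinpi mulrN1 mulr0 addr0 mulrN opprK. Qed.

(* Main.v *)
(** Let X = 2 + 2 cos t, and let phi_k be the Fourier coefficients of X^alpha.  Integrating the
    derivative of X^alpha (1 + e^(it)) e^(-i(k+1)t) over the circle yields
    (alpha + 1 + k) phi_(k+1) = (alpha - k) phi_k.  Hence, up to a factor depending on j only,
    the entry (j, k) of the matrix is f_k(x) + f_k(-x) at x = j + 1/2 for an explicit polynomial
    f_k, that is p_k(x^2) with deg p_k < n.  As p_k vanishes at (alpha + m + 1/2)^2 for
    k < m < n, the determinant at the nodes alpha + m + 1/2 is triangular, and comparing the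
    two families of nodes gives the determinant in closed form.

    With Q_N(z) = prod_(k <= N) (1 + z/k), P_N(z) = prod_(k <= N) (1 + z/k)^k and
    s_N = phi_0 Q_N(2 alpha) / Q_N(alpha)^2, the determinant equals
      s_(2n)^n (P_(2n)(alpha) / P_n(alpha)) (P_n(-1/2) / P_n(alpha - 1/2))
        (Q_(2n)(2 alpha) / Q_n(alpha)),
    and the duplication formula for P turns all but the first factor into Barnes functions.
    To find phi_0, compare X^(alpha + N) with 4^alpha X^N: the measure X^N dt concentrates
    at X = 4, which gives s_N -> 1.  As s_N - s_(N+1) ~ alpha^2 / N^2, it follows that
    N (s_N - 1) -> alpha^2, and s_(2n)^n -> exp (alpha^2 / 2). *)

Require Import Defs.
From HB Require Import structures.
From mathcomp Require Import all_boot all_order all_algebra.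
From mathcomp Require Import all_classical all_reals all_analysis.
From mathcomp Require Import complex measurable_realfun.
From mathcomp Require Import ring lra zify.

Set Implicit Arguments.
Unset Strict Implicit.
Unset Printing Implicit Defensive.

Import Order.TTheory GRing.Theory Num.Theory.
Import numFieldNormedType.Exports.
Import Normc.

Local Open Scope ring_scope.
Local Open Scope complex_scope.

(** * Complex numbers and the complex exponential *)

(** The delicate point is t = pi, where X = 0 and X^alpha is unbounded if Re alpha < 0. The function
    differentiated in the overview has modulus X^(Re alpha + 1/2), so Re alpha > -1/2 makes it
    continuous there, and the boundary terms at pi cancel. That alpha is no integer keeps the
    numbers alpha + m, by which the algebra divides, away from 0. The polynomials f_k come from
    phi_m being proportional to 1/(Gamma(alpha + 1 + m) Gamma(alpha + 1 - m)): one multiplier, even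
    in x, clears the denominators of all entries of a row. The comparison of measures gives phi_0
    Q_(2N)(2 alpha) / Q_N(alpha)^2 -> 4^alpha; since also Q_(2N)(2 alpha) / Q_N(2 alpha) -> 4^alpha,
    this becomes s_N -> 1. The power s_(2n)^n then requires the rate of that convergence. Complex
    logarithms are avoided: non-integer powers are exponentials of multiples of real logarithms, and
    n-th powers are compared by bounding z^n - w^n. *)

Section ComplexModulus.
Variable R : realType.
Implicit Types (z w : R[i]) (x y : R).

Lemma normr_normc z : `|z| = (normc z)%:C.
Proof. by case: z. Qed.

Lemma normc_ge0 z : 0 <= normc z.
Proof. by case: z => a b; rewrite sqrtr_ge0. Qed.

Lemma normc_real x : normc x%:C = `|x|.
Proof. by rewrite /= expr0n /= addr0 sqrtr_sqr. Qed.

Lemma normc_nat n : normc (n%:R : R[i]) = n%:R.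
Proof. by rewrite -(rmorph_nat (real_complex R)) normc_real ger0_norm. Qed.

Lemma normcX z n : normc (z ^+ n) = normc z ^+ n.
Proof. by elim: n => [|n IH]; rewrite ?expr0 ?normc1// !exprS normcM IH. Qed.

Lemma normc_gt0 z : (0 < normc z) = (z != 0).
Proof.
rewrite lt_neqAle normc_ge0 andbT eq_sym; congr (~~ _).
by apply/eqP/eqP => [/eq0_normc //|->]; rewrite normc0.
Qed.

Lemma le_normcB z w : normc (z - w) <= normc z + normc w.
Proof. by rewrite -(normcN w) le_normcD. Qed.

Lemma normc_distC z w : normc (z - w) = normc (w - z).
Proof. by rewrite -(normcN (z - w)) opprB. Qed.

Lemma le_Re_normc z : `|complex.Re z| <= normc z.
Proof. by case: z => a b /=; rewrite -sqrtr_sqr ler_wsqrtr // lerDl sqr_ge0. Qed.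

Lemma le_Im_normc z : `|complex.Im z| <= normc z.
Proof. by case: z => a b /=; rewrite -sqrtr_sqr ler_wsqrtr // lerDr sqr_ge0. Qed.

Lemma normc_le_ReIm z : normc z <= `|complex.Re z| + `|complex.Im z|.
Proof.
rewrite [z in normc z]complexE; apply: (le_trans (le_normcD _ _)).
rewrite normc_real lerD2l normcM normc_real.
by rewrite /= expr0n expr1n /= add0r sqrtr1 mul1r.
Qed.

Lemma ReM z w : complex.Re (z * w) =
  complex.Re z * complex.Re w - complex.Im z * complex.Im w.
Proof. by case: z; case: w. Qed.

Lemma ImM z w : complex.Im (z * w) =
  complex.Re z * complex.Im w + complex.Im z * complex.Re w.
Proof. by case: z; case: w => a b c d /=; rewrite (mulrC d). Qed.

Lemma ReB z w : complex.Re (z - w) = complex.Re z - complex.Re w.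
Proof. by case: z; case: w. Qed.

Lemma ImB z w : complex.Im (z - w) = complex.Im z - complex.Im w.
Proof. by case: z; case: w. Qed.

Lemma ReD z w : complex.Re (z + w) = complex.Re z + complex.Re w.
Proof. by case: z; case: w. Qed.

Lemma ImD z w : complex.Im (z + w) = complex.Im z + complex.Im w.
Proof. by case: z; case: w. Qed.

Lemma ReN z : complex.Re (- z) = - complex.Re z.
Proof. by case: z. Qed.

Lemma ImN z : complex.Im (- z) = - complex.Im z.
Proof. by case: z. Qed.

Lemma complex_eq z w :
  complex.Re z = complex.Re w -> complex.Im z = complex.Im w -> z = w.
Proof. by case: z; case: w => a b c d /= -> ->. Qed.

Lemma normc_phase z : exists2 u, normc u = 1 & complex.Re (u * z) = normc z.
Proof.
have [->|z0] := eqVneq z 0.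
  by exists 1; rewrite ?normc1// mulr0 normc0.
have nz : normc z != 0 by rewrite gt_eqF// normc_gt0.
have zz : conjc z * z = (normc z ^+ 2)%:C.
  case: z {z0 nz} => a b /=; rewrite sqr_sqrtr ?addr_ge0 ?sqr_ge0//.
  by apply: complex_eq => /=; rewrite ?rmorphD /=; ring.
have nconj : normc (conjc z) = normc z by case: z {z0 nz zz} => a b /=; rewrite sqrrN.
exists (conjc z / (normc z)%:C).
  by rewrite normcM normcV normc_real nconj ger0_norm ?normc_ge0// divff.
rewrite mulrAC zz -fmorphV -rmorphM /= expr2 mulfK//.
Qed.

(** Bounds on a modulus become bounds on the real parts of all its rotations. This is how the real
    mean value theorem and the monotonicity of real integrals yield complex estimates. *)
Lemma normc_le_phase z x :
  (forall u, normc u = 1 -> complex.Re (u * z) <= x) -> normc z <= x.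
Proof. by move=> H; have [u /H + <-] := normc_phase z. Qed.

End ComplexModulus.

Section ComplexExponential.
Variable R : realType.
Implicit Types (z w : R[i]) (x y : R).

Lemma Re_cexp z : complex.Re (cexp z) = expR (complex.Re z) * cos (complex.Im z).
Proof. by rewrite /cexp ReM /= mul0r subr0. Qed.

Lemma Im_cexp z : complex.Im (cexp z) = expR (complex.Re z) * sin (complex.Im z).
Proof. by rewrite /cexp ImM /= mul0r addr0. Qed.

Lemma cexp0 : cexp (0 : R[i]) = 1.
Proof. by rewrite /cexp /= expR0 cos0 sin0 mul1r. Qed.

Lemma cexpD z w : cexp (z + w) = cexp z * cexp w.
Proof.
apply: complex_eq; rewrite [RHS](ReM, ImM) ?(Re_cexp, Im_cexp) ReD ImD expRD.
  by rewrite cosD; ring.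
by rewrite sinD; ring.
Qed.

Lemma normc_cexp z : normc (cexp z) = expR (complex.Re z).
Proof.
rewrite /cexp normcM normc_real ger0_norm ?expR_ge0//.
by rewrite /= cos2Dsin2 sqrtr1 mulr1.
Qed.

Lemma cexp_neq0 z : cexp z != 0.
Proof. by rewrite -normc_gt0 normc_cexp expR_gt0. Qed.

Lemma cexpN z : cexp (- z) = (cexp z)^-1.
Proof.
apply: (mulfI (cexp_neq0 z)).
by rewrite -cexpD subrr cexp0 divff ?cexp_neq0.
Qed.

Lemma cexpB z w : cexp (z - w) = cexp z / cexp w.
Proof. by rewrite cexpD cexpN. Qed.

Lemma cexpMn z n : cexp (n%:R * z) = cexp z ^+ n.
Proof.
elim: n => [|n IH]; first by rewrite mul0r cexp0.
by rewrite exprS -IH -cexpD -add1n natrD mulrDl mul1r.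
Qed.

Lemma cexp_real x : cexp x%:C = (expR x)%:C.
Proof. by rewrite /cexp /= cos0 sin0 mulr1. Qed.

Lemma cexp_sum (I : Type) (r : seq I) (P : pred I) (F : I -> R[i]) :
  cexp (\sum_(i <- r | P i) F i) = \prod_(i <- r | P i) cexp (F i).
Proof. by apply: (big_morph _ cexpD cexp0). Qed.

End ComplexExponential.

(** * Complex functions of a real variable: derivatives and the mean value inequality *)

Section ComplexDerivative.
Variable R : realType.
Implicit Types (f g : R -> R[i]) (t : R) (c d z : R[i]).

(** Componentwise, so that the real mean value theorem and the real fundamental theorem of calculus
    apply to each part. *)
Definition is_cderive t f d :=
  is_derive t 1 (fun s => complex.Re (f s)) (complex.Re d) /\
  is_derive t 1 (fun s => complex.Im (f s)) (complex.Im d).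

Lemma is_cderive_eq t f d d' : is_cderive t f d -> d = d' -> is_cderive t f d'.
Proof. by move=> ? <-. Qed.

Lemma is_cderive_cst t c : is_cderive t (fun=> c) 0.
Proof. by split; exact: is_derive_cst. Qed.

Lemma is_cderiveD t f g df dg : is_cderive t f df -> is_cderive t g dg ->
  is_cderive t (fun s => f s + g s) (df + dg).
Proof.
move=> [f1 f2] [g1 g2]; split.
  by under eq_fun do rewrite ReD; rewrite ReD; exact: is_deriveD.
by under eq_fun do rewrite ImD; rewrite ImD; exact: is_deriveD.
Qed.

Lemma is_cderiveN t f df : is_cderive t f df ->
  is_cderive t (fun s => - f s) (- df).
Proof.
move=> [f1 f2]; split.
  by under eq_fun do rewrite ReN; rewrite ReN; exact: is_deriveN.
by under eq_fun do rewrite ImN; rewrite ImN; exact: is_deriveN.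
Qed.

Lemma is_cderiveM t f g df dg : is_cderive t f df -> is_cderive t g dg ->
  is_cderive t (fun s => f s * g s) (df * g t + f t * dg).
Proof.
move=> [f1 f2] [g1 g2]; split.
  under eq_fun do rewrite ReM.
  apply: is_derive_eq; rewrite ReD !ReM /GRing.scale /=; ring.
under eq_fun do rewrite ImM.
apply: is_derive_eq; rewrite ImD !ImM /GRing.scale /=; ring.
Qed.

Lemma is_cderive_real t (h : R -> R) dh : is_derive t 1 h dh ->
  is_cderive t (fun s => (h s)%:C) dh%:C.
Proof. by move=> ?; split=> //=; exact: is_derive_cst. Qed.

Lemma is_cderive_cexp t f df : is_cderive t f df ->
  is_cderive t (fun s => cexp (f s)) (df * cexp (f t)).
Proof.
move=> [f1 f2].
have e1 : is_derive t 1 (fun s => expR (complex.Re (f s)))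
    (expR (complex.Re (f t)) * complex.Re df).
  exact: (@is_derive1_comp _ expR).
have c1 : is_derive t 1 (fun s => cos (complex.Im (f s)))
    (- sin (complex.Im (f t)) * complex.Im df).
  exact: (@is_derive1_comp _ cos).
have s1 : is_derive t 1 (fun s => sin (complex.Im (f s)))
    (cos (complex.Im (f t)) * complex.Im df).
  exact: (@is_derive1_comp _ sin).
split.
  under eq_fun do rewrite Re_cexp.
  apply: is_derive_eq; rewrite ReM Re_cexp Im_cexp /GRing.scale /=; ring.
under eq_fun do rewrite Im_cexp.
apply: is_derive_eq; rewrite ImM Re_cexp Im_cexp /GRing.scale /=; ring.
Qed.

(** For each unimodular u, the real function B - Re (u f) has a nonnegative derivative on [0, b] and
    is nonnegative at 0. *)
Lemma cderive_bound f f' (B B' : R -> R) (b : R) : 0 <= b ->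
  (forall t, is_cderive t f (f' t)) ->
  (forall t, is_derive t 1 B (B' t)) ->
  (forall t, 0 <= t <= b -> normc (f' t) <= B' t) ->
  normc (f 0) <= B 0 -> normc (f b) <= B b.
Proof.
move=> b0 fd Bd le0 f0; apply: normc_le_phase => u u1.
move: b0; rewrite le_eqVlt => /orP[/eqP <-|b0].
  apply: le_trans f0; rewrite -[leRHS]mul1r -u1 -normcM.
  exact: le_trans (ler_norm _) (le_Re_normc _).
pose h s := B s - complex.Re (u * f s).
pose h' s := B' s - complex.Re (u * f' s).
have hd (s : R) : is_derive s 1 h (h' s).
  apply: is_deriveB.
  have [+ _] := is_cderiveM (is_cderive_cst s u) (fd s).
  by rewrite mul0r add0r.
have [c|c cb hE] := MVT b0 (fun s _ => hd s).
  by apply/continuous_subspaceT => s; apply/differentiable_continuous/derivable1_diffP; case: (hd s).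
have h'0 : 0 <= h' c.
  rewrite subr_ge0; apply: le_trans (le0 c _); last first.
    by move: cb; rewrite in_itv /= => /andP[/ltW -> /ltW ->].
  rewrite -[leRHS]mul1r -u1 -normcM.
  exact: le_trans (ler_norm _) (le_Re_normc _).
have : 0 <= h b - h 0 by rewrite hE subr0 mulr_ge0 // ltW.
have h00 : 0 <= h 0.
  rewrite subr_ge0; apply: le_trans f0; rewrite -[leRHS]mul1r -u1 -normcM.
  exact: le_trans (ler_norm _) (le_Re_normc _).
move: h00; rewrite {2}/h; lra.
Qed.

End ComplexDerivative.

(* Otherwise lemmas about products unfold [cexp] when they are used for rewriting. *)
Opaque cexp.

Section ExponentialBounds.
Variable R : realType.
Implicit Types (z w : R[i]) (x y t : R).

Lemma is_cderive_scale z t : is_cderive t (fun s => s%:C * z) z.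
Proof.
have := is_cderiveM (is_cderive_real (is_derive_id t (1 : R))) (is_cderive_cst t z).
by rewrite /= mul1r mulr0 addr0.
Qed.

Lemma Re_scale z t : complex.Re (t%:C * z) = t * complex.Re z.
Proof. by rewrite ReM /= mul0r subr0. Qed.

Lemma normc_scale z t : normc (t%:C * z) = `|t| * normc z.
Proof. by rewrite normcM normc_real. Qed.

Lemma is_cderive_cexp_scale z t :
  is_cderive t (fun s => cexp (s%:C * z)) (z * cexp (t%:C * z)).
Proof. exact: is_cderive_cexp (is_cderive_scale z t). Qed.

Lemma is_derive_scale x t : is_derive t 1 (fun s => s * x) x.
Proof. by apply: is_derive_eq; rewrite /GRing.scale /= mulr0 add0r mulr1. Qed.

Lemma Re_le_normc z : complex.Re z <= normc z.
Proof. exact: le_trans (ler_norm _) (le_Re_normc z). Qed.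

(** The Taylor remainders of orders 0, 1 and 2 are bounded in turn by [cderive_bound] along t z, 0
    <= t <= 1: the derivative of each is z times the preceding one. The majorants are linear in t,
    so no factorials appear in the constants. *)
Lemma normc_cexpB1 z : normc (cexp z - 1) <= normc z * expR (normc z).
Proof.
have := @cderive_bound _ (fun t => cexp (t%:C * z) - 1) (fun t => z * cexp (t%:C * z))
  (fun t => t * (normc z * expR (normc z))) (fun=> normc z * expR (normc z)) 1 ler01.
rewrite !mul1r mul0r cexp0 subrr normc0 mul0r; apply => // t.
- have := is_cderiveD (is_cderive_cexp_scale z t) (is_cderive_cst t (-1)).
  by rewrite addr0.
- exact: is_derive_scale.
- move=> /andP[t0 t1]; rewrite normcM normc_cexp Re_scale.
  rewrite ler_wpM2l ?normc_ge0// ler_expR.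
  apply: le_trans (ler_wpM2l t0 (Re_le_normc z)) _.
  by rewrite ler_piMl ?normc_ge0.
Qed.

Lemma normc_cexpB1_scale z t : 0 <= t <= 1 ->
  normc (cexp (t%:C * z) - 1) <= normc z * expR (normc z).
Proof.
move=> /andP[t0 t1]; apply: le_trans (normc_cexpB1 _) _.
rewrite normc_scale ger0_norm//.
have tz : t * normc z <= normc z by rewrite ler_piMl ?normc_ge0.
by rewrite ler_pM ?mulr_ge0 ?normc_ge0 ?expR_ge0 ?ler_expR.
Qed.

Lemma normc_cexpB1D z :
  normc (cexp z - 1 - z) <= normc z ^+ 2 * expR (normc z).
Proof.
have := @cderive_bound _ (fun t => cexp (t%:C * z) - 1 - t%:C * z)
  (fun t => z * (cexp (t%:C * z) - 1))
  (fun t => t * (normc z ^+ 2 * expR (normc z)))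
  (fun=> normc z ^+ 2 * expR (normc z)) 1 ler01.
rewrite !mul1r !mul0r cexp0 subrr subr0 normc0; apply => // t.
- apply: is_cderive_eq (is_cderiveD (is_cderiveD (is_cderive_cexp_scale z t)
    (is_cderive_cst t (-1))) (is_cderiveN (is_cderive_scale z t))) _.
  by ring.
- exact: is_derive_scale.
- move=> t01; rewrite normcM expr2 -mulrA ler_wpM2l ?normc_ge0//.
  exact: normc_cexpB1_scale.
Qed.

Lemma normc_cexpB1DX2 z :
  normc (cexp z - 1 - z - z ^+ 2 / 2) <= normc z ^+ 3 * expR (normc z).
Proof.
have := @cderive_bound _ (fun t => cexp (t%:C * z) - 1 - t%:C * z - (t%:C * z) * (t%:C * z) / 2)
  (fun t => z * (cexp (t%:C * z) - 1 - t%:C * z))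
  (fun t => t * (normc z ^+ 3 * expR (normc z)))
  (fun=> normc z ^+ 3 * expR (normc z)) 1 ler01.
rewrite !mul1r !mul0r cexp0 subrr !subr0 normc0 -expr2; apply => // t.
- have dX := is_cderiveM (is_cderive_scale z t) (is_cderive_scale z t).
  have dX2 := is_cderiveN (is_cderiveM dX (is_cderive_cst t 2^-1)).
  apply: is_cderive_eq (is_cderiveD (is_cderiveD (is_cderiveD
    (is_cderive_cexp_scale z t)
    (is_cderive_cst t (-1))) (is_cderiveN (is_cderive_scale z t))) dX2) _.
  by field.
- exact: is_derive_scale.
- move=> /andP[t0 t1]; rewrite normcM exprS -mulrA ler_wpM2l ?normc_ge0//.
  apply: le_trans (normc_cexpB1D _) _.
  rewrite normc_scale ger0_norm//.
  have tz : t * normc z <= normc z by rewrite ler_piMl ?normc_ge0.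
  rewrite ler_pM ?expr_ge0 ?mulr_ge0 ?normc_ge0 ?expR_ge0 ?ler_expR//.
  by rewrite lerXn2r ?nnegrE ?mulr_ge0 ?normc_ge0.
Qed.

(** With x = e^(K/n) the factor x^n stays equal to e^K, so closeness of z and w passes to their n-th
    powers at the cost of a factor n. *)
Lemma normc_subXX z w x n : 1 <= x -> normc z <= x -> normc w <= x ->
  normc (z ^+ n - w ^+ n) <= n%:R * normc (z - w) * x ^+ n.
Proof.
move=> x1 zx wx; have x0 : 0 <= x by apply: le_trans x1.
elim: n => [|n IH]; first by rewrite !expr0 subrr normc0 !mul0r.
have -> : z ^+ n.+1 - w ^+ n.+1 = z * (z ^+ n - w ^+ n) + (z - w) * w ^+ n.
  by rewrite !exprS; ring.
apply: le_trans (le_normcD _ _) _; rewrite !normcM normcX.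
have wn : normc w ^+ n <= x ^+ n by rewrite lerXn2r// nnegrE normc_ge0.
have e1 : normc z * normc (z ^+ n - w ^+ n) <= x * (n%:R * normc (z - w) * x ^+ n).
  by rewrite ler_pM ?normc_ge0.
have e2 : normc (z - w) * normc w ^+ n <= x * (normc (z - w) * x ^+ n).
  apply: (@le_trans _ _ (normc (z - w) * x ^+ n)).
    by rewrite ler_wpM2l ?normc_ge0.
  by rewrite ler_peMl// mulr_ge0 ?normc_ge0// exprn_ge0.
apply: le_trans (lerD e1 e2) _.
by rewrite -[n.+1]addn1 natrD exprD expr1 le_eqVlt; apply/orP; left; apply/eqP; ring.
Qed.

End ExponentialBounds.

(** * Limits of complex sequences and infinite products *)

Section ComplexSequences.
Variable R : realType.
Implicit Types (u v : nat -> R[i]^o) (l : R[i]^o).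
Local Open Scope classical_set_scope.

Lemma normr_normc_regular l : `|l| = (normc l)%:C.
Proof. exact: normr_normc. Qed.

Lemma cvgc_normP u l :
  u @ \oo --> l <-> (fun n => normc (l - u n)) @ \oo --> (0 : R).
Proof.
split=> [/cvgrPdist_le ul|/cvgrPdist_le ul]; apply/cvgrPdist_le => e e0.
  have e0' : 0 < e%:C by rewrite ltcR.
  move: (ul _ e0'); apply: filterS => n.
  by rewrite normr_normc_regular lecR sub0r normrN ger0_norm ?normc_ge0.
(* The radii of the topology of [R[i]^o] are positive elements of [R[i]], hence real. *)
case: e e0 => a b; rewrite ltcE /= => /andP[/eqP -> a0].
move: (ul _ a0); apply: filterS => n.
by rewrite sub0r normrN ger0_norm ?normc_ge0// normr_normc_regular lecR.
Qed.

Lemma cvgc_squeeze u l (e : nat -> R) :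
  (\forall n \near \oo, normc (l - u n) <= e n) -> e @ \oo --> (0 : R) -> u @ \oo --> l.
Proof.
move=> ule e0; apply/cvgc_normP.
apply: (@squeeze_cvgr _ _ _ _ (fun=> 0) e) => //; last exact: cvg_cst.
by move: ule; apply: filterS => n ->; rewrite normc_ge0.
Qed.

Lemma cvgc_Re u l : u @ \oo --> l ->
  (fun n => complex.Re (u n)) @ \oo --> complex.Re l.
Proof.
move=> /cvgc_normP/cvgrPdist_le H; apply/cvgrPdist_le => e /H.
apply: filterS => n; rewrite sub0r normrN ger0_norm ?normc_ge0//.
by apply: le_trans; rewrite -ReB le_Re_normc.
Qed.

Lemma cvgc_Im u l : u @ \oo --> l ->
  (fun n => complex.Im (u n)) @ \oo --> complex.Im l.
Proof.
move=> /cvgc_normP/cvgrPdist_le H; apply/cvgrPdist_le => e /H.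
apply: filterS => n; rewrite sub0r normrN ger0_norm ?normc_ge0//.
by apply: le_trans; rewrite -ImB le_Im_normc.
Qed.

Lemma cvgc_normc u l : u @ \oo --> l -> (fun n => normc (u n)) @ \oo --> normc l.
Proof.
move=> /cvgc_normP/cvgrPdist_le H; apply/cvgrPdist_le => e /H.
apply: filterS => n; rewrite sub0r normrN ger0_norm ?normc_ge0//.
apply: le_trans; rewrite ler_norml; apply/andP; split.
  have := le_normcB l (l - u n); rewrite opprB addrC subrK; lra.
have := le_normcD (l - u n) (u n); rewrite subrK; lra.
Qed.

Lemma cvgc_ReIm u (a b : R) :
  (fun n => complex.Re (u n)) @ \oo --> a ->
  (fun n => complex.Im (u n)) @ \oo --> b -> u @ \oo --> (a +i* b : R[i]^o).
Proof.
move=> ua ub.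
apply: (@cvgc_squeeze _ _ (fun n => `|a - complex.Re (u n)| + `|b - complex.Im (u n)|)).
  near=> n; apply: le_trans (normc_le_ReIm _) _.
  by rewrite ReB ImB.
rewrite -[0]addr0; apply: cvgD; apply/norm_cvg0P.
  by rewrite -(subrr a); apply: cvgB => //; exact: cvg_cst.
by rewrite -(subrr b); apply: cvgB => //; exact: cvg_cst.
Unshelve. all: by end_near. Qed.

Lemma cvgc_real (x : nat -> R) (a : R) : x @ \oo --> a ->
  (fun n => (x n)%:C : R[i]^o) @ \oo --> (a%:C : R[i]^o).
Proof. by move=> xa; apply: cvgc_ReIm => //=; exact: cvg_cst. Qed.

Lemma cvgcM u v l (m : R[i]^o) : u @ \oo --> l -> v @ \oo --> m ->
  (fun n => u n * v n : R[i]^o) @ \oo --> (l * m : R[i]^o).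
Proof.
move=> ul vm.
have [rl il] := (cvgc_Re ul, cvgc_Im ul); have [rm im] := (cvgc_Re vm, cvgc_Im vm).
have -> : l * m = (complex.Re (l * m) +i* complex.Im (l * m)) by case: (l * m).
apply: cvgc_ReIm.
  under eq_fun do rewrite ReM; rewrite ReM.
  by apply: cvgB; apply: cvgM.
under eq_fun do rewrite ImM; rewrite ImM.
by apply: cvgD; apply: cvgM.
Qed.

Lemma cvgcMl (c : R[i]^o) u l : u @ \oo --> l ->
  (fun n => c * u n : R[i]^o) @ \oo --> (c * l : R[i]^o).
Proof. by move=> ul; apply: cvgcM; [exact: cvg_cst|exact: ul]. Qed.

Lemma cvgcV u l : l != 0 -> u @ \oo --> l ->
  (fun n => (u n)^-1 : R[i]^o) @ \oo --> (l^-1 : R[i]^o).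
Proof. by move=> l0 ul; apply: cvgV. Qed.

Lemma cvgcX u l k : u @ \oo --> l ->
  (fun n => u n ^+ k : R[i]^o) @ \oo --> (l ^+ k : R[i]^o).
Proof.
move=> ul; elim: k => [|k IH]; first exact: cvg_cst.
by under eq_fun do rewrite exprS; rewrite exprS; exact: cvgcM.
Qed.

(** The sequence x + y decreases and x - y increases; since y >= 0, the former is bounded below by
    x_0 - y_0, so it converges, and y tends to 0. *)
Lemma is_cvg_telescope (x y : nat -> R) : y @ \oo --> (0 : R) ->
  (forall n, `|x n.+1 - x n| <= y n - y n.+1) -> cvgn x.
Proof.
move=> y0 xy.
have ydec : {homo y : m n / (m <= n)%N >-> n <= m}.
  by apply/nonincreasing_seqP => n; rewrite -subr_ge0; apply: le_trans (xy n).
have yge0 n : 0 <= y n.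
  by rewrite -(cvg_lim _ y0)//; apply: nonincreasing_cvgn_ge => //; apply/cvg_ex; exists 0.
have zdec : {homo (fun n => x n + y n) : m n / (m <= n)%N >-> n <= m}.
  apply/nonincreasing_seqP => n; have := xy n; rewrite ler_norml; lra.
have zinc : {homo (fun n => x n - y n) : m n / (m <= n)%N >-> m <= n}.
  apply/nondecreasing_seqP => n; have := xy n; rewrite ler_norml; lra.
have : cvgn (fun n => x n + y n).
  apply: nonincreasing_is_cvgn => //; exists (x 0 - y 0) => _ [n _ <-].
  have := zinc 0 n (leq0n _); have := yge0 n; rewrite /=; lra.
move=> /cvg_ex[l xl]; apply/cvg_ex; exists (l - 0).
have -> : x = (fun n => x n + y n - y n) by apply/funext => n; rewrite addrK.
exact: cvgB.
Qed.

Lemma cvgc_telescope u (y : nat -> R) : y @ \oo --> (0 : R) ->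
  (forall n, normc (u n.+1 - u n) <= y n - y n.+1) ->
  exists l, u @ \oo --> l.
Proof.
move=> y0 uy.
have /cvg_ex[a ra] : cvgn (fun n => complex.Re (u n)).
  apply: (is_cvg_telescope y0) => n.
  by apply: le_trans (uy n); rewrite -ReB le_Re_normc.
have /cvg_ex[b rb] : cvgn (fun n => complex.Im (u n)).
  apply: (is_cvg_telescope y0) => n.
  by apply: le_trans (uy n); rewrite -ImB le_Im_normc.
by exists (a +i* b); exact: cvgc_ReIm.
Qed.

Lemma telescope_tail u l (y : nat -> R) (N n : nat) : u @ \oo --> l -> y @ \oo --> (0 : R) ->
  (forall m, (N <= m)%N -> normc (u m.+1 - u m) <= y m - y m.+1) -> (N <= n)%N ->
  normc (l - u n) <= y n.
Proof.
move=> ul y0 uy Nn.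
have le k : normc (u (k + n)%N - u n) <= y n - y (k + n)%N.
  elim: k => [|k IH]; first by rewrite add0n !subrr normc0.
  have -> : u (k.+1 + n)%N - u n = (u (k + n).+1 - u (k + n)%N) + (u (k + n)%N - u n).
    by rewrite addrA subrK.
  apply: le_trans (le_normcD _ _) _.
  apply: le_trans (lerD (uy _ (leq_trans Nn (leq_addl _ _))) IH) _.
  by rewrite addSn; lra.
have c1 : (fun k => normc (u (k + n)%N - u n)) @ \oo --> normc (l - u n).
  apply: (@cvgc_normc (fun k => u (k + n)%N - u n)).
  by apply: cvgB; [rewrite (cvg_shiftn n u)|exact: cvg_cst].
have c2 : (fun k => y n - y (k + n)%N) @ \oo --> y n - 0.
  by apply: cvgB; [exact: cvg_cst|rewrite (cvg_shiftn n y)].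
rewrite -[leRHS]subr0.
by apply: (ler_cvg_to c1 c2); exact: nearW.
Qed.

(** The decrements of e make the sum of |a_n - 1| telescope. Partial products are bounded by
    exp(e_0), whence convergence. They stay away from 0 because from an index N with e_N <= 1/2 on,
    at most half of the modulus is lost. *)
Lemma cvgc_prod (a : nat -> R[i]) (e : nat -> R) : e @ \oo --> (0 : R) ->
  (forall n, a n != 0) -> (forall n, normc (a n - 1) <= e n - e n.+1) ->
  exists2 l : R[i]^o, l != 0 &
    (fun n => \prod_(k < n) a k : R[i]^o) @ \oo --> l.
Proof.
move=> e0 an0 ae; pose p n : R[i]^o := \prod_(k < n) a k.
have pS n : p n.+1 = p n * a n by rewrite /p big_ord_recr.
have pSB n : p n.+1 - p n = p n * (a n - 1) by rewrite pS mulrBr mulr1.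
have edec : {homo e : m n / (m <= n)%N >-> n <= m}.
  apply/nonincreasing_seqP => n; rewrite -subr_ge0.
  exact: le_trans (normc_ge0 _) (ae n).
have ege0 n : 0 <= e n.
  by rewrite -(cvg_lim _ e0)//; apply: nonincreasing_cvgn_ge => //; apply/cvg_ex; exists 0.
have ple n : normc (p n) <= expR (e 0%N - e n).
  elim: n => [|n IH]; first by rewrite /p big_ord0 normc1 subrr expR0.
  rewrite pS normcM.
  have -> : e 0%N - e n.+1 = (e 0%N - e n) + (e n - e n.+1) by rewrite addrA subrK.
  rewrite expRD ler_pM ?normc_ge0//.
  have -> : a n = 1 + (a n - 1) by rewrite addrC subrK.
  apply: le_trans (le_normcD _ _) _; rewrite normc1.
  by apply: le_trans (expR_ge1Dx _); rewrite lerD2l.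
have [l pl] : exists l, p @ \oo --> l.
  apply: (@cvgc_telescope p (fun n => expR (e 0%N) * e n)).
    by rewrite -(mulr0 (expR (e 0%N))); apply: cvgMr.
  move=> n; rewrite pSB normcM -mulrBr ler_pM ?normc_ge0//.
  by apply: le_trans (ple n) _; rewrite ler_expR gerBl.
exists l => //; rewrite -normc_gt0.
have [N eN] : exists N, e N <= 1 / 2.
  have /cvgrPdist_le/(_ (1 / 2)) := e0.
  have h2 : 0 < 1 / 2 :> R by lra.
  move=> /(_ h2) [N _ /(_ N (leqnn N))] /=.
  by rewrite sub0r normrN => /(le_trans (ler_norm _)); exists N.
have pN : 0 < normc (p N) by rewrite normc_gt0; apply/prodf_neq0.
(* Weierstrass inequality: a product of factors 1 - x_i is at least 1 minus the sum of the x_i, here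
   with x_i a decrement of e. *)
have pge k : normc (p N) * (1 - e N + e (k + N)%N) <= normc (p (k + N)%N).
  elim: k => [|k IH]; first by rewrite add0n subrK mulr1.
  rewrite addSn pS normcM.
  have a1 : 1 - (e (k + N)%N - e (k + N).+1) <= normc (a (k + N)%N).
    have := le_normcD (a (k + N)%N) (1 - a (k + N)%N).
    rewrite addrC subrK normc1 normc_distC; have := ae (k + N)%N; lra.
  set x := normc (p N) in pN IH *; set y := normc (p (k + N)%N) in IH *.
  set c := normc (a _) in a1 *.
  have e1 : e (k + N)%N <= e N by apply: edec; rewrite leq_addl.
  have e2 : e (k + N).+1 <= e (k + N)%N by apply: edec.
  have e3 := ege0 (k + N).+1.
  move: (e (k + N)%N) (e (k + N).+1) (e N) e1 e2 e3 eN IH a1 => e1 e2 eN.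
  move=> *; apply: (@le_trans _ _ ((x * (1 - eN + e1)) * (1 - (e1 - e2)))).
    rewrite -mulrA ler_wpM2l ?(ltW pN)//; nra.
  by rewrite ler_pM ?mulr_ge0 ?(ltW pN)//; lra.
apply: (@lt_le_trans _ _ (normc (p N) / 2)); first by rewrite divr_gt0.
have c1 : (fun=> normc (p N) / 2) @ \oo --> normc (p N) / 2 by exact: cvg_cst.
have c2 : (fun k => normc (p (k + N)%N)) @ \oo --> normc l.
  by apply: (@cvgc_normc (fun k => p (k + N)%N)); rewrite (cvg_shiftn N p).
apply: (ler_cvg_to c1 c2); apply: nearW => k; apply: le_trans (pge k); rewrite ler_wpM2l ?(ltW pN)//.
  by have := ege0 (k + N)%N; lra.
Qed.

End ComplexSequences.

(** * Limits of Gamma and Barnes products *)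

Section LimitsOfProducts.
Variable R : realType.
Implicit Types (z w c : R[i]) (x y t : R) (n k : nat).
Local Open Scope classical_set_scope.

Lemma cvg_mul_harmonic (C : R) : (fun n => C * n.+1%:R^-1) @ \oo --> (0 : R).
Proof. by rewrite -(mulr0 C); apply: cvgMr; exact: cvg_harmonic. Qed.

Lemma invr_sqr_telescope n :
  (n.+1%:R ^+ 2)^-1 <= 2 * n.+1%:R^-1 - 2 * n.+2%:R^-1 :> R.
Proof.
have n1 : 0 < n.+1%:R :> R by [].
rewrite -[n.+2]addn1 natrD; set x := n.+1%:R in n1 *.
have x1 : 1 <= x by rewrite ler1n.
rewrite -subr_ge0.
have -> : 2 * x^-1 - 2 * (x + 1)^-1 - (x ^+ 2)^-1 = (x - 1) / (x ^+ 2 * (x + 1)).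
  by field; rewrite !gt_eqF//; lra.
by rewrite divr_ge0 ?mulr_ge0 ?exprn_ge0//; lra.
Qed.

Lemma cvgc_prod_invsqr (a : nat -> R[i]) (K : R) : (forall n, a n != 0) ->
  (forall n, normc (a n - 1) <= K * (n.+1%:R^-1) ^+ 2) ->
  exists2 l : R[i]^o, l != 0 & (fun n => \prod_(k < n) a k : R[i]^o) @ \oo --> l.
Proof.
move=> a0 aK; apply: (cvgc_prod (e := fun n => (K * 2) * n.+1%:R^-1)) => //.
  exact: cvg_mul_harmonic.
have K0 : 0 <= K.
  by have := le_trans (normc_ge0 _) (aK 0); rewrite invr1 expr1n mulr1.
move=> n; apply: le_trans (aK n) _.
rewrite -!mulrA -mulrBr ler_wpM2l// exprVn.
exact: invr_sqr_telescope.
Qed.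

(** The lower bound is the upper one applied to 1/(1 + x), as 1 - 1/(1 + x) >= x - x^2. *)
Lemma ln1D_bounds x : 0 < x -> x - x ^+ 2 <= ln (1 + x) <= x.
Proof.
move=> x0; have x1 : 0 < 1 + x by lra.
apply/andP; split; last by apply: le_ln1Dx; lra.
have : ln ((1 + x)^-1) <= (1 + x)^-1 - 1.
  have := @le_ln1Dx R ((1 + x)^-1 - 1).
  rewrite addrCA subrr addr0; apply; rewrite ltrBrDl subrr invr_gt0//.
rewrite lnV ?posrE// => H.
have -> : x - x ^+ 2 = 1 - (1 + x)^-1 - x ^+ 3 / (1 + x) by field; rewrite gt_eqF.
have : 0 <= x ^+ 3 / (1 + x) by rewrite divr_ge0 ?exprn_ge0// ltW.
lra.
Qed.

(** A factor (1 + x z)(1 + x)^(-z) of Euler's product for 1/Gamma(1 + z), at x = 1/(n + 1): the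
    first-order terms cancel, so the factors differ from 1 by a summable amount. *)
Lemma normc_powerB1 z x : 0 < x <= 1 ->
  normc ((1 + x%:C * z) * cexp (- ((ln (1 + x))%:C * z)) - 1) <=
  (normc z + normc z ^+ 2 + (1 + normc z) * (normc z ^+ 2 * expR (normc z))) * x ^+ 2.
Proof.
move=> /andP[x0 x1]; have /andP[L1 L2] := ln1D_bounds x0.
set L := ln _ in L1 L2 *.
have L0 : 0 <= L by apply: ln_ge0; lra.
set w := - (L%:C * z).
have nw : normc w = L * normc z by rewrite normcN normc_scale ger0_norm.
(* Here e^w is 1 + w plus a quadratic remainder; the linear terms leave only (x - L) z, and x - L <=
   x^2. *)
have -> : (1 + x%:C * z) * cexp w - 1 =
    (x - L)%:C * z - (x * L)%:C * (z * z) + (1 + x%:C * z) * (cexp w - 1 - w).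
  by rewrite /w !rmorphM !rmorphB; ring.
have r := normc_cexpB1D w.
have z0 := normc_ge0 z.
have Lz : L * normc z <= x * normc z by rewrite ler_wpM2r.
have r' : normc (cexp w - 1 - w) <= x ^+ 2 * (normc z ^+ 2 * expR (normc z)).
  apply: le_trans r _; rewrite nw exprMn -mulrA.
  rewrite ler_pM ?exprn_ge0 ?mulr_ge0 ?expR_ge0//.
    by rewrite lerXn2r ?nnegrE// ltW.
  rewrite ler_wpM2l ?exprn_ge0// ler_expR.
  by apply: le_trans Lz _; rewrite ler_piMl.
apply: le_trans (le_normcD _ _) _.
rewrite [leRHS]mulrDl; apply: lerD.
  apply: le_trans (le_normcB _ _) _; rewrite [leRHS]mulrDl; apply: lerD.
    rewrite normc_scale mulrC ler_wpM2l// ger0_norm; lra.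
  have xL : x * L <= x ^+ 2 by rewrite expr2 ler_wpM2l// ltW.
  rewrite normc_scale normcM ger0_norm; last by rewrite mulr_ge0// ltW.
  by rewrite -[normc z * normc z]expr2 mulrC ler_wpM2l ?exprn_ge0.
rewrite normcM -[leRHS]mulrA ler_pM ?normc_ge0//.
  apply: le_trans (le_normcD _ _) _; rewrite normc1 lerD2l normc_scale.
  by rewrite ger0_norm ?(ltW x0)// ler_piMl.
by rewrite mulrC.
Qed.

(** Q_n(z) of the overview; Q_n(z) n^(-z) tends to 1/Gamma(1 + z). The next definition is P_n(z). *)
Definition gamma_prod z n : R[i] := \prod_(k < n) (1 + z / k.+1%:R).

Definition barnes_prod z n : R[i] := \prod_(k < n) (1 + z / k.+1%:R) ^+ k.+1.

Lemma gamma_prodS z n : gamma_prod z n.+1 = gamma_prod z n * (1 + z / n.+1%:R).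
Proof. exact: big_ord_recr. Qed.

Lemma barnes_prodS z n :
  barnes_prod z n.+1 = barnes_prod z n * (1 + z / n.+1%:R) ^+ n.+1.
Proof. exact: big_ord_recr. Qed.

Definition no_neg_int z := forall n, 1 + z / n.+1%:R != 0.

Lemma gamma_prod_neq0 z n : no_neg_int z -> gamma_prod z n != 0.
Proof. by move=> z0; apply/prodf_neq0 => k _; exact: z0. Qed.

Lemma barnes_prod_neq0 z n : no_neg_int z -> barnes_prod z n != 0.
Proof. by move=> z0; apply/prodf_neq0 => k _; rewrite expf_neq0. Qed.

Lemma natr_complex n : (n%:R : R)%:C = n%:R :> R[i].
Proof. exact: rmorph_nat. Qed.

Lemma invn_complex n : (n%:R^-1 : R)%:C = n%:R^-1 :> R[i].
Proof. by rewrite fmorphV rmorph_nat. Qed.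

Lemma lnS n : ln n.+2%:R = ln n.+1%:R + ln (1 + n.+1%:R^-1) :> R.
Proof.
rewrite -lnM ?posrE ?addr_gt0 ?invr_gt0//; congr ln.
by rewrite mulrDr mulr1 divff// -[n.+2]addn1 natrD.
Qed.

(** Normalising by (n + 1)^z rather than n^z makes the expression an exact product, since n + 1 is
    the product of the 1 + 1/k for k <= n. *)
Lemma gamma_prod_cvg z : no_neg_int z ->
  exists2 l : R[i]^o, l != 0 &
   (fun n => gamma_prod z n * cexp (- ((ln n.+1%:R)%:C * z)) : R[i]^o) @ \oo --> l.
Proof.
move=> z0; pose a n := (1 + (n.+1%:R^-1)%:C * z) * cexp (- ((ln (1 + n.+1%:R^-1))%:C * z)).
have [| |l l0 al] := @cvgc_prod_invsqr a
  (normc z + normc z ^+ 2 + (1 + normc z) * (normc z ^+ 2 * expR (normc z))).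
- by move=> n; rewrite /a mulf_neq0 ?cexp_neq0// invn_complex mulrC; exact: z0.
- move=> n; apply: normc_powerB1.
  by rewrite invr_gt0 ltr0n /= invf_le1 ?ler1n.
exists l => //; suff -> : (fun n => gamma_prod z n * cexp (- ((ln n.+1%:R)%:C * z)))
  = (fun n => \prod_(k < n) a k) by [].
apply/funext; elim=> [|n IH].
  by rewrite /gamma_prod !big_ord0 mul1r ln1 mul0r oppr0 cexp0.
rewrite gamma_prodS big_ord_recr -IH /= /a lnS rmorphD /= mulrDl opprD cexpD.
by rewrite invn_complex [_^-1 * z]mulrC; ring.
Qed.

Lemma cvgc_cexp (u : nat -> R[i]^o) (l : R[i]^o) : u @ \oo --> l ->
  (fun n => cexp (u n) : R[i]^o) @ \oo --> (cexp l : R[i]^o).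
Proof.
move=> ul; have rl := cvgc_Re ul; have il := cvgc_Im ul.
have -> : cexp l = (complex.Re (cexp l) +i* complex.Im (cexp l)) by case: (cexp l).
rewrite Re_cexp Im_cexp; apply: cvgc_ReIm.
  under eq_fun do rewrite Re_cexp.
  apply: cvgM; first by apply: continuous_cvg => //; exact: continuous_expR.
  by apply: continuous_cvg => //; exact: continuous_cos.
under eq_fun do rewrite Im_cexp.
apply: cvgM; first by apply: continuous_cvg => //; exact: continuous_expR.
by apply: continuous_cvg => //; exact: continuous_sin.
Qed.

Lemma cvg_double : (fun n => n.*2) @ \oo --> \oo.
Proof.
move=> A [N _ NA]; exists N => // n /= Nn; apply: NA => /=.
by apply: leq_trans Nn _; rewrite -addnn leq_addr.
Qed.

Lemma cvg_harmonic_ratio : (fun n => n.*2.+1%:R / n.+1%:R : R) @ \oo --> (2 : R).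
Proof.
have -> : (fun n => n.*2.+1%:R / n.+1%:R : R) = (fun n => 2 - 1 * n.+1%:R^-1).
  apply/funext => n; rewrite -[n.*2.+1]addn1 -muln2 natrD natrM -[n.+1]addn1 natrD.
  by field; rewrite natr1 pnatr_eq0.
rewrite -[X in _ --> X]subr0; apply: cvgB; first exact: cvg_cst.
exact: cvg_mul_harmonic.
Qed.

Lemma cvgc_double_ratio (u : nat -> R[i]^o) (l : R[i]^o) : l != 0 -> u @ \oo --> l ->
  (fun n => u n.*2 / u n : R[i]^o) @ \oo --> (1 : R[i]^o).
Proof.
move=> l0 ul; have ul2 : (fun n => u n.*2) @ \oo --> l by apply: (cvg_comp _ u cvg_double ul).
by have := cvgcM ul2 (cvgcV l0 ul); rewrite [l * _]mulfV.
Qed.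

(** The normalised products at 2n and n have the same nonzero limit, so the ratio of Q_(2n) and Q_n
    behaves like that of the normalisations, ((2n + 1)/(n + 1))^z. *)
Lemma gamma_prod_double z : no_neg_int z ->
  (fun n => gamma_prod z n.*2 / gamma_prod z n : R[i]^o) @ \oo -->
    (cexp ((ln 2)%:C * z) : R[i]^o).
Proof.
move=> z0; have [l l0 zl] := gamma_prod_cvg z0.
set u := fun n => _ in zl.
have u0 n : u n != 0 by rewrite /u mulf_neq0 ?gamma_prod_neq0 ?cexp_neq0.
have H1 := cvgc_double_ratio l0 zl.
have H2 : (fun n => (ln (n.*2.+1%:R / n.+1%:R))%:C * z : R[i]^o) @ \oo --> ((ln 2)%:C * z : R[i]^o).
  apply: cvgcM; last exact: cvg_cst.
  apply: cvgc_real; apply: (cvg_comp _ (@ln R) cvg_harmonic_ratio).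
  exact: continuous_ln.
have := cvgcM H1 (cvgc_cexp H2); rewrite mul1r; apply: cvg_trans; apply: near_eq_cvg.
apply: nearW => n; rewrite /u ln_div ?posrE// rmorphB /= mulrBl cexpB !cexpN.
have := cexp_neq0 ((ln n.*2.+1%:R)%:C * z); have := cexp_neq0 ((ln n.+1%:R)%:C * z).
have := gamma_prod_neq0 n z0.
move: (cexp _) (cexp _) (gamma_prod _ _) (gamma_prod _ _) => x y p q x0 y0 q0.
by field; rewrite x0 y0 q0.
Qed.

End LimitsOfProducts.

(** * Barnes products, and limits of n-th powers *)

Section BarnesLimit.
Variable R : realType.
Implicit Types (z w c : R[i]) (x y t : R) (n k : nat).
Local Open Scope classical_set_scope.

Lemma euler_gamma_cvg :
  (fun n => \sum_(k < n) (k.+1%:R)^-1 - ln n%:R) @ \oo --> euler_gamma R.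
Proof.
(* With ln (n + 1) in place of ln n the increments are 1/(n + 1) - ln (1 + 1/(n + 1)), between 0 and
   1/(n + 1)^2. *)
pose v n : R := \sum_(k < n) (k.+1%:R)^-1 - ln n.+1%:R.
pose u n : R := \sum_(k < n) (k.+1%:R)^-1 - ln n%:R.
have vS n : v n.+1 - v n = n.+1%:R^-1 - ln (1 + n.+1%:R^-1).
  by rewrite /v big_ord_recr /= lnS; ring.
have b n : n.+1%:R^-1 - n.+1%:R^-1 ^+ 2 <= ln (1 + n.+1%:R^-1 : R) <= n.+1%:R^-1.
  by apply: ln1D_bounds; rewrite invr_gt0.
have /cvg_ex[g vg] : cvgn v.
  apply: (is_cvg_telescope (cvg_mul_harmonic (2 : R))) => n.
  apply: le_trans (invr_sqr_telescope R n); rewrite -exprVn vS.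
  have /andP[b1 b2] := b n.
  by rewrite ger0_norm ?subr_ge0// lerBlDr -lerBlDl.
have ug : u @ \oo --> g.
  rewrite -(cvg_shiftS u).
  have -> : (fun n => u n.+1) = (fun n => v n + n.+1%:R^-1).
    by apply/funext => n; rewrite /u /v big_ord_recr /=; ring.
  rewrite -[g]addr0; apply: cvgD => //; exact: cvg_harmonic.
rewrite (_ : euler_gamma R = g)// /euler_gamma.
under eq_fun do rewrite big_add1 /= big_mkord.
exact: cvg_lim.
Qed.

(** With w = z/(n + 1), the base (1 + w) e^(-w + w^2/2) is 1 + O(w^3), and its power n + 1 is 1 +
    O(1/n^2). In the constant, M bounds (n + 1) |-w + w^2/2|, and (n + 1)^(-3) K bounds the distance
    of the base from 1. *)
Lemma barnes_factor_bound z n :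
  normc (((1 + z / n.+1%:R) * cexp (- (z / n.+1%:R) + (z / n.+1%:R) ^+ 2 / 2))
     ^+ n.+1 - 1) <=
  (let m := normc z in let M := m + m ^+ 2 in
   let K := m ^+ 3 * (1 + m + m ^+ 2) + (1 + m) * (M ^+ 3 * expR M) in
   K * expR K) * n.+1%:R^-1 ^+ 2.
Proof.
lazy zeta; set w := z / _; set m := normc z; set M := m + m ^+ 2.
set K := m ^+ 3 * _ + _.
set x : R := n.+1%:R^-1.
have x0 : 0 < x by rewrite invr_gt0.
have xV : x^-1 = n.+1%:R by rewrite invrK.
have x1 : x <= 1 by rewrite invf_le1 ?ler1n.
have m0 : 0 <= m := normc_ge0 z.
have M0 : 0 <= M by rewrite addr_ge0 ?exprn_ge0.
have K0 : 0 <= K by rewrite /K !(addr_ge0, mulr_ge0, exprn_ge0, expR_ge0).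
have x0' := ltW x0.
have nw : normc w = x * m by rewrite normcM normcV normc_nat mulrC.
clearbody w.
have nwm : normc w <= m by rewrite nw ler_piMl.
have nw0 : 0 <= normc w := normc_ge0 w.
set v := - w + w ^+ 2 / 2.
have half : normc (2^-1 : R[i]) = 2^-1 by rewrite normcV (normc_nat R 2).
have nv : normc v <= x * M.
  apply: le_trans (le_normcD _ _) _; rewrite normcN normcM normcX half nw.
  have : 0 <= x * m ^+ 2 * (1 - x / 2).
    by rewrite mulr_ge0 ?mulr_ge0 ?exprn_ge0//; lra.
  rewrite /M; clear -m; move: m => m; nra.
have xM : x * M <= M by rewrite ler_piMl.
set c := (1 + w) * cexp v.
have c1 : normc (c - 1) <= x ^+ 3 * K.
  (* The first term is (1 + w)(1 + v + v^2/2) - 1, a polynomial divisible by w^3; the second carries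
     the Taylor remainder of e^v. *)
  have -> : c - 1 = w ^+ 3 * (1 / 2 - 3 / 8 * w + w ^+ 2 / 8) +
      (1 + w) * (cexp v - 1 - v - v ^+ 2 / 2).
    by rewrite /c /v; move: (cexp _) => e; field.
  rewrite [x ^+ 3 * K]mulrDr; apply: le_trans (le_normcD _ _) _; apply: lerD.
    rewrite normcM normcX nw exprMn -[leLHS]mulrA.
    have x3p : 0 <= x ^+ 3 by rewrite exprn_ge0 ?(ltW x0).
    have m3p : 0 <= m ^+ 3 by rewrite exprn_ge0.
    rewrite (ler_wpM2l x3p)// (ler_wpM2l m3p)//.
    have e1 : normc (1 / 2 : R[i]) <= 1 by rewrite mul1r half; lra.
    have e3 : normc (3 / 8 : R[i]) <= 1.
      by rewrite normcM normcV (normc_nat R 3) (normc_nat R 8); lra.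
    have e8 : normc (8^-1 : R[i]) <= 1 by rewrite normcV (normc_nat R 8); lra.
    apply: le_trans (le_normcD _ _) _; apply: lerD.
      apply: le_trans (le_normcB _ _) _; apply: lerD => //.
      by rewrite normcM; apply: le_trans nwm; rewrite ler_piMl.
    rewrite normcM normcX; apply: (@le_trans _ _ (normc w ^+ 2)).
      by rewrite ler_piMr ?exprn_ge0.
    by rewrite lerXn2r ?nnegrE.
  rewrite normcM mulrCA ler_pM ?normc_ge0//.
    by apply: le_trans (le_normcD _ _) _; rewrite normc1 lerD2l.
  apply: le_trans (normc_cexpB1DX2 _) _.
  rewrite mulrA -exprMn ler_pM ?exprn_ge0 ?normc_ge0 ?expR_ge0//.
    by rewrite lerXn2r ?nnegrE ?normc_ge0 ?mulr_ge0 ?(ltW x0).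
  by rewrite ler_expR (le_trans nv).
have x3 : x ^+ 3 <= x by rewrite exprS ler_piMr ?(ltW x0)// expr_le1// ltW.
have cX : normc c <= expR (x * K).
  have -> : c = 1 + (c - 1) by rewrite addrC subrK.
  apply: le_trans (le_normcD _ _) _; rewrite normc1.
  apply: le_trans (expR_ge1Dx _); rewrite lerD2l.
  by apply: le_trans c1 _; rewrite ler_wpM2r.
have X1 : 1 <= expR (x * K) by rewrite -expR0 ler_expR mulr_ge0// ltW.
have := @normc_subXX _ c 1 (expR (x * K)) n.+1 X1 cX.
rewrite normc1 expr1n => /(_ X1) /le_trans; apply.
have -> : expR (x * K) ^+ n.+1 = expR K.
  by rewrite -expRM_natl; congr expR; rewrite -xV; field; rewrite gt_eqF.
have -> : K * expR K * x ^+ 2 = (n.+1%:R * (x ^+ 3 * K)) * expR K.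
  by rewrite -xV; field; rewrite gt_eqF.
by rewrite ler_wpM2r ?expR_ge0// ler_wpM2l.
Qed.

(** The n-th partial product of G(1 + z) without (2 pi)^(z/2), in which the harmonic number minus
    Euler's constant has been replaced by ln n. *)
Definition barnes_norm z n : R[i] :=
  barnes_prod z n * cexp (- ((z + 1) * z / 2) + (ln n%:R)%:C * z ^+ 2 / 2 - n%:R * z).

Lemma barnes_norm_cvg z : no_neg_int z ->
  exists l : R[i]^o, [/\ l != 0, (fun n => barnes_norm z n : R[i]^o) @ \oo --> l &
    barnesG (1 + z) = cpow (2 * pi) (z / 2) * l].
Proof.
move=> z0.
pose a n := ((1 + z / n.+1%:R) * cexp (- (z / n.+1%:R) + (z / n.+1%:R) ^+ 2 / 2)) ^+ n.+1.
have [|l l0 al] := @cvgc_prod_invsqr _ a _ _ (barnes_factor_bound z).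
  by move=> n; rewrite /a expf_neq0// mulf_neq0 ?cexp_neq0//; exact: z0.
have aE n : a n = (1 + z / n.+1%:R) ^+ n.+1 * cexp (- z + z ^+ 2 / (2 * n.+1%:R)).
  rewrite /a exprMn -cexpMn; congr (_ * cexp _).
  by have : (n.+1%:R : R[i]) != 0 by []; move: (n.+1%:R) => x x0; field.
pose h n : R := \sum_(k < n) (k.+1%:R)^-1 - ln n%:R.
pose E := cexp (- ((z + 1) * z / 2) - (euler_gamma R)%:C * z ^+ 2 / 2).
have hl : (fun n => cexp (- ((z + 1) * z / 2) - (h n)%:C * z ^+ 2 / 2) : R[i]^o)
    @ \oo --> (E : R[i]^o).
  apply: cvgc_cexp; apply: cvgB; first exact: cvg_cst.
  apply: cvgcM; last exact: cvg_cst.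
  apply: cvgcM; last exact: cvg_cst.
  by apply: cvgc_real; exact: euler_gamma_cvg.
exists (l * E); split.
- by rewrite mulf_neq0 ?cexp_neq0.
- have := cvgcM al hl; apply: cvg_trans; apply: near_eq_cvg; apply: nearW => n.
  rewrite (eq_bigr _ (fun (k : 'I_n) _ => aE k)) big_split /= -cexp_sum.
  rewrite -[LHS]mulrA -cexpD; congr (_ * cexp _).
  rewrite big_split /= sumr_const card_ord -[- z *+ n]mulr_natl.
  have -> : \sum_(k < n) z ^+ 2 / (2 * k.+1%:R) =
      (\sum_(k < n) (k.+1%:R)^-1)%:C * z ^+ 2 / 2.
    rewrite rmorph_sum /= !mulr_suml; apply: eq_bigr => k _.
    rewrite invn_complex; have : (k.+1%:R : R[i]) != 0 by [].
    by move: (k.+1%:R) => x x0; field.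
  by rewrite /h rmorphB /=; field.
have zE : 1 + z - 1 = z by rewrite addrC addKr.
rewrite /barnesG zE -mulrA [_ * E]mulrC; congr (_ * (_ * _)).
rewrite (_ : (fun n => _) = (fun n => \prod_(k < n) a k)); first exact: (cvg_lim (@norm_hausdorff _ _) al).
apply/funext => n.
by rewrite big_add1 /= big_mkord; apply: eq_bigr => k _; rewrite aE.
Qed.

(** Instead of taking logarithms, a_n is compared with b = e^(c/n), whose n-th power is e^c. Both
    have modulus at most e^(K/n) once |c - n (a_n - 1)| <= 1, and n (b - a_n) tends to 0. *)
Lemma cvgc_exprn (a : nat -> R[i]^o) (c : R[i]^o) :
  (fun n => n%:R * (a n - 1) : R[i]^o) @ \oo --> c ->
  (fun n => a n ^+ n : R[i]^o) @ \oo --> (cexp c : R[i]^o).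
Proof.
move=> ac; pose K := normc c + 1.
have K0 : 0 <= K by rewrite addr_ge0 ?normc_ge0.
have c0 := normc_ge0 c.
pose C := normc c ^+ 2 * expR (normc c).
pose d n := normc (c - n%:R * (a n - 1)).
apply: (@cvgc_squeeze _ _ _ (fun n => (d n + C * n%:R^-1) * expR K)); last first.
  rewrite -[X in _ --> X](mul0r (expR K)); apply: cvgM; last exact: cvg_cst.
  rewrite -[X in _ --> X]addr0; apply: cvgD; first exact/cvgc_normP.
  by rewrite -(cvg_shiftS (fun n => C * n%:R^-1)); exact: cvg_mul_harmonic.
near=> n.
have n0 : (0 < n)%N by near: n; exact: nbhs_infty_gt.
have d1 : d n <= 1.
  near: n; have /cvgc_normP/cvgrPdist_le/(_ 1 ltr01) := ac.
  by apply: filterS => n; rewrite sub0r normrN ger0_norm ?normc_ge0.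
have nn : (n%:R : R) != 0 by rewrite pnatr_eq0 -lt0n.
have nc : (n%:R : R[i]) != 0 by rewrite pnatr_eq0 -lt0n.
have n1 : 0 < n%:R^-1 :> R by rewrite invr_gt0 ltr0n.
have n1' : n%:R^-1 <= 1 :> R by rewrite invf_le1 ?ler1n ?ltr0n.
set b := cexp (c / n%:R).
have bn : b ^+ n = cexp c by rewrite -cexpMn mulrC divfK.
rewrite -bn.
have an : normc (a n - 1) <= n%:R^-1 * K.
  have -> : a n - 1 = n%:R^-1 * (c - (c - n%:R * (a n - 1))).
    by rewrite opprB addrCA subrr addr0 mulKf.
  rewrite normcM normcV normc_nat ler_wpM2l ?(ltW n1)//.
  by apply: le_trans (le_normcB _ _) _; rewrite lerD2l.
have nb : normc (c / n%:R) = n%:R^-1 * normc c by rewrite normcM normcV normc_nat mulrC.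
have aX : normc (a n) <= expR (n%:R^-1 * K).
  have -> : a n = 1 + (a n - 1) by rewrite addrC subrK.
  apply: le_trans (le_normcD _ _) _; rewrite normc1.
  by apply: le_trans (expR_ge1Dx _); rewrite lerD2l.
have bX : normc b <= expR (n%:R^-1 * K).
  rewrite normc_cexp ler_expR; apply: le_trans (Re_le_normc _) _.
  by rewrite nb ler_wpM2l ?(ltW n1)// lerDl.
have X1 : 1 <= expR (n%:R^-1 * K) by rewrite -expR0 ler_expR mulr_ge0// ltW.
have := @normc_subXX _ _ _ _ n X1 bX aX => /le_trans; apply.
rewrite -expRM_natl mulrA divff// mul1r ler_wpM2r ?expR_ge0//.
have -> : b - a n = n%:R^-1 * (c - n%:R * (a n - 1)) + (b - 1 - c / n%:R).
  by field.
apply: (@le_trans _ _ (n%:R * (n%:R^-1 * d n + C * n%:R^-1 ^+ 2))); last first.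
  by rewrite le_eqVlt; apply/orP; left; apply/eqP; field.
rewrite ler_wpM2l//; apply: le_trans (le_normcD _ _) _; apply: lerD.
  by rewrite normcM normcV normc_nat.
apply: le_trans (normc_cexpB1D _) _.
have n1w := ltW n1.
rewrite nb exprMn -[leLHS]mulrA [leRHS]mulrC ler_wpM2l ?exprn_ge0//.
by rewrite /C ler_wpM2l ?exprn_ge0// ler_expR ler_piMl.
Unshelve. all: by end_near. Qed.

(** The 0/0 form of the Stolz-Cesaro theorem, with denominator 1/(n + 1), whose decrement is 1/((n +
    1)(n + 2)). From some index on, the increments of u_n - L/(n + 1) are at most e times these
    decrements, and the tail telescopes. *)
Lemma stolz (u : nat -> R[i]^o) (l L : R[i]^o) : u @ \oo --> l ->
  (fun n => n.+1%:R * n.+2%:R * (u n - u n.+1) : R[i]^o) @ \oo --> L ->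
  (fun n => n.+1%:R * (u n - l) : R[i]^o) @ \oo --> L.
Proof.
move=> ul uL; apply/cvgc_normP/cvgrPdist_le => e e0.
have /cvgc_normP/cvgrPdist_le/(_ e e0)[N _ Ne] := uL.
exists N => // n /= Nn; rewrite sub0r normrN ger0_norm ?normc_ge0//.
pose w n : R[i]^o := u n - L * n.+1%:R^-1.
have wl : w @ \oo --> l.
  have h0 : (fun n => (n.+1%:R^-1)%:C : R[i]^o) @ \oo --> (0%:C : R[i]^o).
    by apply: cvgc_real; exact: cvg_harmonic.
  have Lh := cvgcMl (c := L) h0.
  have lL : l - L * 0%:C = l by rewrite [L * _]mulr0 [LHS]subr0.
  have -> : w = (fun n => u n - L * (n.+1%:R^-1)%:C).
    by apply/funext => k; rewrite /w -invn_complex.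
  have H := cvgB ul Lh; rewrite lL in H; exact: H.
have nc k : (k.+1%:R : R[i]) != 0 by rewrite pnatr_eq0.
have step m : (N <= m)%N -> normc (w m.+1 - w m) <= e * m.+1%:R^-1 - e * m.+2%:R^-1.
  move=> Nm; have := Ne m Nm; rewrite /= sub0r normrN ger0_norm ?normc_ge0// => H.
  have -> : w m.+1 - w m =
      (m.+1%:R * m.+2%:R)^-1 * (L - m.+1%:R * m.+2%:R * (u m - u m.+1)).
    by rewrite /w; move: (nc m) (nc m.+1); rewrite -[m.+2%:R]natr1; move: (m.+1%:R) => x x0 x1; field; rewrite x0 x1.
  rewrite normcM normcV normcM !normc_nat.
  have -> : e * m.+1%:R^-1 - e * m.+2%:R^-1 = (m.+1%:R * m.+2%:R)^-1 * e.
    have n1 : (m.+1%:R : R) != 0 by []. have n2 : (m.+2%:R : R) != 0 by [].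
    by move: n1 n2; rewrite -[m.+2%:R]natr1; move: (m.+1%:R) => x x0 x1; field; rewrite x0 x1.
  by rewrite ler_wpM2l// invr_ge0 mulr_ge0.
have H := telescope_tail wl (cvg_mul_harmonic e) step Nn.
have -> : L - n.+1%:R * (u n - l) = n.+1%:R * (l - w n).
  by rewrite /w; move: (nc n); move: (n.+1%:R) => x x0; field.
rewrite normcM normc_nat -ler_pdivlMl ?ltr0n// mulrC; exact: H.
Qed.

End BarnesLimit.

(** * The Toeplitz plus Hankel determinant *)

Section ToeplitzHankelDeterminant.
Variable F : numFieldType.
Implicit Types (a x y : F) (n k j m : nat).

Definition rise x n : F := \prod_(i < n) (x + i%:R).

Lemma rise0 x : rise x 0 = 1.
Proof. exact: big_ord0. Qed.

Lemma riseS x n : rise x n.+1 = rise x n * (x + n%:R).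
Proof. exact: big_ord_recr. Qed.

Lemma riseSl x n : rise x n.+1 = x * rise (x + 1) n.
Proof.
rewrite /rise big_ord_recl addr0; congr (_ * _); apply: eq_bigr => i _.
by rewrite lift0 -addn1 natrD -addrA [1 + _]addrC.
Qed.

Lemma riseD x m n : rise x (m + n) = rise x m * rise (x + m%:R) n.
Proof.
elim: n => [|n IH]; first by rewrite addn0 rise0 mulr1.
by rewrite addnS !riseS IH natrD mulrA addrA.
Qed.

Lemma rise_rev x n : \prod_(i < n) (x + (n - i)%:R) = rise (x + 1) n.
Proof.
rewrite (reindex_inj rev_ord_inj) /rise; apply: eq_bigr => i _ /=.
by rewrite subKn// -natr1; ring.
Qed.

Lemma rise_eq0 x n i : (i < n)%N -> x + i%:R = 0 -> rise x n = 0.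
Proof.
by move=> lin xi; rewrite /rise (bigD1 (Ordinal lin))//= xi mul0r.
Qed.

Lemma rise1 n : rise 1 n = n`!%:R.
Proof.
elim: n => [|n IH]; first by rewrite rise0.
by rewrite riseS IH factS mulnC natrM -[n.+1]add1n natrD.
Qed.

Lemma natrM_fact_rise n : n`!%:R * rise n.+1%:R n = (n.*2)`!%:R.
Proof.
by rewrite -!rise1 -addnn riseD -[n.+1]add1n natrD.
Qed.

(** The nodes form a sequence independent of n, so that passing to n + 1 only adds the factors of
    the last node. *)
Definition vandermonde_prod (x : nat -> F) n :=
  \prod_(i < n) \prod_(j < n | (i < j)%N) (x j - x i).

Lemma vandermonde_prodS (x : nat -> F) n :
  vandermonde_prod x n.+1 = vandermonde_prod x n * \prod_(i < n) (x n - x i).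
Proof.
rewrite /vandermonde_prod big_ord_recr /= [X in _ * X]big1 ?mulr1; last first.
  by move=> j; rewrite ltnNge -ltnS ltn_ord.
rewrite -big_split /=; apply: eq_bigr => i _.
by rewrite big_mkcond big_ord_recr /= ltn_ord -big_mkcond.
Qed.

Lemma vandermonde_prod_neq0 (x : nat -> F) n : (forall i j, (i < j)%N -> x j - x i != 0) ->
  vandermonde_prod x n != 0.
Proof.
by move=> H; apply/prodf_neq0 => i _; apply/prodf_neq0 => j; exact: H.
Qed.

Lemma det_Vandermonde_nat (x : nat -> F) n :
  \det (\matrix_(i < n, j < n) x j ^+ i) = vandermonde_prod x n.
Proof.
have -> : \matrix_(i < n, j < n) x j ^+ i = Vandermonde n (\row_(j < n) x j).
  by apply/matrixP => i j; rewrite !mxE.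
rewrite det_Vandermonde; apply: eq_bigr => i _; apply: eq_bigr => j _.
by rewrite !mxE.
Qed.

(* An even polynomial of degree < 2n in x is one of degree < n in x^2. *)
Lemma det_even_poly (f : nat -> {poly F}) (x y : nat -> F) n :
  (forall k, (k < n)%N -> size (f k) <= n.*2)%N ->
  \det (\matrix_(k < n, j < n) ((f k).[x j] + (f k).[- x j])) *
    vandermonde_prod (fun j => y j ^+ 2) n =
  \det (\matrix_(k < n, j < n) ((f k).[y j] + (f k).[- y j])) *
    vandermonde_prod (fun j => x j ^+ 2) n.
Proof.
move=> sf.
pose C := \matrix_(k < n, i < n) (2 * (even_poly (f k))`_i).
have CE z : \matrix_(k < n, j < n) ((f k).[z j] + (f k).[- z j]) =
    C *m \matrix_(i < n, j < n) (z j ^+ 2) ^+ i.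
  apply/matrixP => k j; rewrite !mxE.
  have E w : (f k).[w] = (even_poly (f k)).[w ^+ 2] + (odd_poly (f k)).[w ^+ 2] * w.
    by rewrite -{1}(poly_even_odd (f k)) !hornerE !horner_comp !hornerE.
  rewrite !E sqrrN; set o := (odd_poly _).[_].
  have -> : forall u v : F, u + o * v + (u + o * - v) = 2 * u by move=> u v; ring.
  rewrite (@horner_coef_wide _ n); last first.
    apply: leq_trans (size_even_poly _) _.
    by rewrite leq_uphalf_double; apply: sf.
  rewrite mulr_sumr; apply: eq_bigr => i _.
  by rewrite !mxE mulrA.
by rewrite !CE !det_mulmx !(det_Vandermonde_nat (fun j => _ j ^+ 2)) mulrAC.
Qed.

Lemma size_prod_linear n (c : F) (b : 'I_n -> F) :
  (size (\prod_(i < n) (c *: 'X + (b i)%:P))%R <= n.+1)%N.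
Proof.
elim: n b => [|n IH] b; first by rewrite big_ord0 size_polyC oner_eq0.
rewrite big_ord_recr /=; apply: leq_trans (size_polyMleq _ _) _.
have s2 : (size (c *: 'X + (b ord_max)%:P)%R <= 2)%N.
  apply: leq_trans (size_polyD _ _) _; rewrite geq_max.
  by rewrite (leq_trans (size_scale_leq _ _)) ?size_polyX// (leq_trans (size_polyC_leq1 _)).
have := IH (fun i => b (widen_ord (leqnSn n) i)).
move: (size _) (size _) s2 => p q; lia.
Qed.

(** From here on the Fourier coefficients are represented by an arbitrary solution of their
    recurrence, and the determinant is a matter of algebra. *)
Variables (a : F) (phi : int -> F).
Hypothesis a_nonint : forall m : int, a + m%:~R != 0.
Hypothesis a2_npos : forall m, 2 * a + m.+1%:R != 0.
Hypothesis phi_rec : forall k : int,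
  (a + 1 + k%:~R) * phi (k + 1) = (a - k%:~R) * phi k.

(** Replacing k by -k-1 exchanges the coefficients on the two sides of the recurrence, so phi is
    determined by phi 0 in the same way in both directions. *)
Lemma phi_even m : phi (- m%:Z) = phi m%:Z.
Proof.
elim: m => [|m IH]; first by rewrite oppr0.
have e1 := phi_rec m; have := phi_rec (- m%:Z - 1); rewrite subrK IH => e2.
have -> : - m.+1%:Z = - m%:Z - 1 by rewrite -addn1 PoszD opprD.
have -> : m.+1%:Z = m%:Z + 1 by rewrite -addn1 PoszD.
apply: (mulfI (a_nonint (m%:Z + 1))).
have -> : a + (m%:Z + 1)%:~R = a - (- m%:Z - 1)%:~R.
  by rewrite rmorphB rmorphN rmorphD /=; ring.
rewrite -e2.
have -> : a + 1 + (- m%:Z - 1)%:~R = a - m%:~R by rewrite rmorphB rmorphN /=; ring.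
rewrite -e1; congr (_ * _); rewrite rmorphB rmorphN /=; ring.
Qed.

(** Up to a constant, phi_m is 1/(Gamma(a + 1 + m) Gamma(a + 1 - m)). At m = y - k this is
    multiplied by Gamma(a + 1 + y + n) Gamma(a - y + n), which clears the denominators for all k < n
    and is invariant under y -> -1 - y, that is x -> -x for x = y + 1/2. *)
Definition th_rows n k y : F :=
  rise (a + 1 + y - k%:R) (n + k) * rise (a - y + k.+1%:R) (n - k.+1).

Lemma th_rows_step n k y : (k.+1 < n)%N ->
  (a - y + k.+1%:R) * th_rows n k.+1 y = (a + y - k%:R) * th_rows n k y.
Proof.
move=> kn; rewrite /th_rows addnS riseSl.
have -> : (n - k.+1 = (n - k.+2).+1)%N by lia.
rewrite [rise (a - y + k.+1%:R) _]riseSl -[k.+2%:R]natr1 -[k.+1%:R]natr1.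
have -> : a + 1 + y - (k%:R + 1) = a + y - k%:R by ring.
have -> : a + y - k%:R + 1 = a + 1 + y - k%:R by ring.
have -> : a - y + (k%:R + 1) + 1 = a - y + (k%:R + 1 + 1) by ring.
by ring.
Qed.

Lemma phi_th_rows n k (y : int) : (k < n)%N ->
  phi (y - k%:Z) * th_rows n 0 y%:~R = phi y * th_rows n k y%:~R.
Proof.
elim: k => [|k IH] kn; first by rewrite subr0.
have {}IH := IH (ltnW kn).
have a0 : a - y%:~R + k.+1%:R != 0.
  have := a_nonint (- y + k.+1%:Z).
  by rewrite rmorphD rmorphN /= addrA.
apply: (mulfI a0); rewrite [RHS]mulrCA th_rows_step// [RHS]mulrCA -IH.
rewrite mulrA [RHS]mulrA; congr (_ * _).
have := phi_rec (y - k.+1%:Z).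
have -> : y - k.+1%:Z + 1 = y - k%:Z by rewrite -addn1 PoszD; ring.
have kE : k.+1%:~R = k%:R + 1 :> F by rewrite natr1.
rewrite rmorphB /= kE -[k.+1%:R]natr1.
have -> : a + 1 + (y%:~R - (k%:R + 1)) = a + y%:~R - k%:R by ring.
move->; congr (_ * _); ring.
Qed.

Lemma rise_int_neq0 (m : int) n x : x = a + m%:~R -> rise x n != 0.
Proof.
move=> ->; apply/prodf_neq0 => i _.
by have := a_nonint (m + i%:Z); rewrite rmorphD /= addrA.
Qed.

Lemma th_rows0_neq0 n (y : int) : th_rows n 0 y%:~R != 0.
Proof.
rewrite mulf_neq0//.
  by apply: (@rise_int_neq0 (y + 1)); rewrite rmorphD /=; ring.
by apply: (@rise_int_neq0 (1 - y)); rewrite rmorphB /=; ring.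
Qed.

(** The invariance of the multiplier: phi y / [th_rows n 0 y] takes the same value at j and at -1 -
    j. *)
Lemma th_rows0_refl n j : (0 < n)%N ->
  phi (-1 - j%:Z) * th_rows n 0 j%:R = phi j%:Z * th_rows n 0 (-1 - j%:R).
Proof.
move=> n0; have a1 : a + 1 + j%:R != 0.
  have := a_nonint (1 + j%:Z); by rewrite rmorphD /= addrA.
have -> : -1 - j%:Z = - j.+1%:Z by rewrite -addn1 PoszD; ring.
rewrite phi_even; apply: (mulfI a1); rewrite mulrA.
have -> : (a + 1 + j%:R) * phi j.+1 = (a - j%:R) * phi j.
  by have := phi_rec j; rewrite -[j.+1]addn1 PoszD.
case: n n0 => // n _; rewrite /th_rows subn1 /= addn0 !riseSl !subr0.
have -> : a + 1 + (-1 - j%:R) = a - j%:R by ring.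
have -> : a - (-1 - j%:R) + 1 = a + 1 + j%:R + 1 by ring.
have -> : a - j%:R + 1 = a - j%:R + 1%:R by [].
by ring.
Qed.

(** As phi is even, the Hankel term phi (j + k + 1) is the Toeplitz term phi (y - k) at the
    reflected point y = -1 - j. *)
Lemma th_entry n j k : (k < n)%N ->
  (phi (j%:Z - k%:Z) + phi (j%:Z + k%:Z + 1)) * th_rows n 0 j%:R =
  phi j%:Z * (th_rows n k j%:R + th_rows n k (-1 - j%:R)).
Proof.
move=> kn; rewrite mulrDl mulrDr (phi_th_rows j%:Z kn); congr (_ + _).
have -> : j%:Z + k%:Z + 1 = (j + k + 1)%N%:Z by rewrite !PoszD.
rewrite -phi_even.
have -> : - (j + k + 1)%N%:Z = (-1 - j%:Z) - k%:Z by rewrite !PoszD; ring.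
have e1 := phi_th_rows (-1 - j%:Z) kn.
have e2 := th_rows0_refl j (leq_ltn_trans (leq0n k) kn).
have r0 := th_rows0_neq0 n (-1 - j%:Z).
have jE : (-1 - j%:Z)%:~R = -1 - j%:R :> F by rewrite rmorphB rmorphN /=.
rewrite jE in e1 r0; apply: (mulfI r0).
by rewrite mulrA [_ * phi _]mulrC e1 mulrAC e2; ring.
Qed.

(** f_k of the overview: [th_rows n k] in the variable x = y + 1/2. The two leading coefficients are
    displayed so that [size_prod_linear] covers both products. *)
Definition th_poly n k : {poly F} :=
  (\prod_(i < n + k) (1 *: 'X + (a + 1 / 2 - k%:R + i%:R)%:P)) *
  (\prod_(i < n - k.+1) ((-1) *: 'X + (a + 1 / 2 + k.+1%:R + i%:R)%:P)).

Lemma horner_th_poly n k y : (th_poly n k).[y + 1 / 2] = th_rows n k y.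
Proof.
rewrite /th_poly hornerM !horner_prod; congr (_ * _); apply: eq_bigr => i _.
  by rewrite !(hornerD, hornerZ, hornerX, hornerC); field.
by rewrite !(hornerD, hornerZ, hornerX, hornerC); field.
Qed.

Lemma size_th_poly n k : (k < n)%N -> (size (th_poly n k) <= n.*2)%N.
Proof.
move=> kn; apply: leq_trans (size_polyMleq _ _) _.
have := size_prod_linear 1 (fun i : 'I_(n + k) => a + 1 / 2 - k%:R + i%:R).
have := size_prod_linear (-1) (fun i : 'I_(n - k.+1) => a + 1 / 2 + k.+1%:R + i%:R).
move: (size _) (size _) => p q; lia.
Qed.

Definition th_node j : F := (a + j%:R) + 1 / 2.

(** At y = a + m the parameter a drops out of one rising factorial of each term. The reflected term
    contains the factor -(m + k) + (m + k); for k < m the direct term contains (k + 1 - m) + (m - k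
    - 1). *)
Lemma th_rows_node n k m : (m < n)%N -> (k <= m)%N ->
  th_rows n k (a + m%:R) + th_rows n k (-1 - (a + m%:R)) =
  if m == k then rise (2 * a + 1) (n + k) * (n - k.+1)`!%:R else 0.
Proof.
move=> mn km; rewrite /th_rows.
rewrite [X in _ + X * _](@rise_eq0 _ _ (m + k)) ?ltn_add2r//; last first.
  by rewrite natrD; ring.
rewrite mul0r addr0; case: eqP => [->|/eqP mk].
  rewrite -rise1 -natr1; congr (rise _ _ * rise _ _); ring.
have lkm : (k < m)%N by rewrite ltn_neqAle eq_sym mk.
rewrite [X in _ * X](@rise_eq0 _ _ (m - k.+1)) ?mulr0//; first by lia.
by rewrite natrB//; ring.
Qed.

Lemma det_th_node n :
  \det (\matrix_(k < n, j < n) ((th_poly n k).[th_node j] + (th_poly n k).[- th_node j])) =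
  \prod_(k < n) (rise (2 * a + 1) (n + k) * (n - k.+1)`!%:R).
Proof.
have E (k j : 'I_n) : (k <= j)%N ->
  (th_poly n k).[th_node j] + (th_poly n k).[- th_node j] =
  if j == k :> nat then rise (2 * a + 1) (n + k) * (n - k.+1)`!%:R else 0.
  move=> kj; rewrite -(th_rows_node (ltn_ord j) kj) /th_node horner_th_poly.
  have -> : - (a + j%:R + 1 / 2) = -1 - (a + j%:R) + 1 / 2 by field.
  by rewrite horner_th_poly.
rewrite det_trig.
  by apply: eq_bigr => k _; rewrite mxE E// eqxx.
by apply/is_trig_mxP => k j kj; rewrite mxE E ?(ltnW kj)// gtn_eqF.
Qed.

Lemma half_node_diff i j :
  (j%:R + 1 / 2) ^+ 2 - (i%:R + 1 / 2) ^+ 2 = (j%:R - i%:R) * (j + i).+1%:R :> F.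
Proof. by rewrite -[(j + i).+1%:R]natr1 natrD; field. Qed.

(** The factor j - i is common to both families of nodes and cancels in the ratio of the Vandermonde
    products. *)
Lemma th_node_diff i j :
  th_node j ^+ 2 - th_node i ^+ 2 = (j%:R - i%:R) * (2 * a + (j + i).+1%:R).
Proof. by rewrite /th_node -[(j + i).+1%:R]natr1 natrD; field. Qed.

Lemma natr_diff_neq0 i j : (i < j)%N -> j%:R - i%:R != 0 :> F.
Proof. by move=> ij; rewrite -natrB ?(ltnW ij)// pnatr_eq0 -lt0n subn_gt0. Qed.

Definition th_det n :=
  \prod_(j < n) (phi j%:Z / th_rows n 0 j%:R) *
  (vandermonde_prod (fun j => (j%:R + 1 / 2) ^+ 2) n /
   vandermonde_prod (fun j => th_node j ^+ 2) n) *
  \prod_(k < n) (rise (2 * a + 1) (n + k) * (n - k.+1)`!%:R).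

Lemma vandermonde_node_neq0 n : vandermonde_prod (fun j => th_node j ^+ 2) n != 0.
Proof.
apply: vandermonde_prod_neq0 => i j ij.
by rewrite th_node_diff mulf_neq0// natr_diff_neq0.
Qed.

Lemma det_th n :
  \det (\matrix_(j < n, k < n) (phi (j%:Z - k%:Z) + phi (j%:Z + k%:Z + 1))) = th_det n.
Proof.
have V0 := vandermonde_node_neq0 n.
pose P := \matrix_(k < n, j < n)
  ((th_poly n k).[j%:R + 1 / 2] + (th_poly n k).[- (j%:R + 1 / 2)]).
have -> : \matrix_(j < n, k < n) (phi (j%:Z - k%:Z) + phi (j%:Z + k%:Z + 1)) =
   diag_mx (\row_(j < n) (phi j%:Z / th_rows n 0 j%:R)) *m P^T.
  apply/matrixP => j k; rewrite mul_diag_mx !mxE horner_th_poly.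
  have -> : - (j%:R + 1 / 2) = -1 - j%:R + 1 / 2 :> F by field.
  rewrite horner_th_poly mulrAC -th_entry// mulfK//.
  exact: (th_rows0_neq0 n j).
rewrite det_mulmx det_diag det_tr /th_det -mulrA; congr (_ * _).
  by apply: eq_bigr => j _; rewrite mxE.
have := @det_even_poly (th_poly n) (fun j => j%:R + 1 / 2) th_node n
  (fun k => @size_th_poly n k).
rewrite det_th_node -/P => H; apply: (mulIf V0); rewrite H.
by rewrite [RHS]mulrAC divfK// mulrC.
Qed.

Lemma phi_rise n : phi n%:Z * rise (a + 1) n = phi 0 * rise (a - n%:R + 1) n.
Proof.
elim: n => [|n IH]; first by rewrite !rise0.
rewrite riseS [in RHS]riseSl.
have -> : a - n.+1%:R + 1 = a - n%:R by rewrite -natr1; ring.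
have e : (a + 1 + n%:R) * phi (n%:Z + 1) = (a - n%:R) * phi n%:Z := phi_rec n.
have -> : phi n.+1%:Z * (rise (a + 1) n * (a + 1 + n%:R)) =
    (a + 1 + n%:R) * phi (n%:Z + 1) * rise (a + 1) n by rewrite -addn1 PoszD; ring.
by rewrite e -mulrA IH; ring.
Qed.

(** The three factors of [th_det] are compared separately at n + 1 and n; the growth of the earlier
    terms collapses to factorials and rising factorials. *)
Lemma th_det_step n : th_det n.+1 = th_det n *
  (phi 0 * n.*2`!%:R * rise (2 * a + 1) n.*2.+1 /
     (rise (a + 1) n.*2 * rise (a + 1) n.*2.+1)).
Proof.
have ai (m : int) : a + m%:~R != 0 by [].
(* The factor that [th_rows n 0 j] gains when n becomes n + 1. *)
pose A j : F := (a + 1 + j%:R + n%:R) * (a + (n - j)%:R).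
have A0 j : (j < n)%N -> A j != 0.
  move=> jn; rewrite mulf_neq0//; first by have := ai (1 + j%:Z + n%:Z); rewrite !rmorphD /= !addrA.
  by have := ai (n - j)%N.
have e1 : \prod_(j < n.+1) (phi j%:Z / th_rows n.+1 0 j%:R) =
  \prod_(j < n) (phi j%:Z / th_rows n 0 j%:R) * \prod_(j < n) (A j)^-1 *
  (phi n%:Z / th_rows n.+1 0 n%:R).
  rewrite big_ord_recr /= -big_split /=; congr (_ * _); apply: eq_bigr => j _.
  rewrite -mulrA; congr (_ * _); rewrite -invfM; congr (_^-1).
  rewrite /th_rows !addn0 !subr0 riseS subn1 /=.
  case: n j {A0} @A => [[//]|p] j A; rewrite subn1 /= [rise (a - _ + _) _]riseS /A.
  by rewrite natrB ?(ltnW (ltn_ord j))// -[p.+1%:R]natr1; ring.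
have e2 : vandermonde_prod (fun j => (j%:R + 1 / 2 : F) ^+ 2) n.+1 /
    vandermonde_prod (fun j => th_node j ^+ 2) n.+1 =
    vandermonde_prod (fun j => (j%:R + 1 / 2) ^+ 2) n /
    vandermonde_prod (fun j => th_node j ^+ 2) n *
    \prod_(j < n) ((n + j).+1%:R / (2 * a + (n + j).+1%:R)).
  rewrite !vandermonde_prodS invfM mulrACA; congr (_ * _); rewrite -prodfV -big_split /=.
  apply: eq_bigr => j _; rewrite half_node_diff th_node_diff.
  have := natr_diff_neq0 (ltn_ord j); have := a2_npos (n + j).
  move: (n%:R - j%:R) ((n + j).+1%:R) => u v u0 v0; field.
  by rewrite u0 v0.
have e3 : \prod_(k < n.+1) (rise (2 * a + 1) (n.+1 + k) * (n.+1 - k.+1)`!%:R) =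
  \prod_(k < n) (rise (2 * a + 1) (n + k) * (n - k.+1)`!%:R) *
  \prod_(k < n) ((2 * a + (n + k).+1%:R) * (n - k)%:R) * rise (2 * a + 1) n.*2.+1.
  rewrite big_ord_recr /= -big_split /= subnn fact0 mulr1 addSn addnn; congr (_ * _).
  apply: eq_bigr => k _; rewrite addSn riseS subSS.
  have -> : (n - k = (n - k.+1).+1)%N by have := ltn_ord k; lia.
  by rewrite factS natrM -[(n + k).+1%:R]natr1; ring.
rewrite /th_det e1 e2 e3.
have -> : forall p q r s t u v w : F, p * q * r * (s * t) * (u * v * w) =
  p * s * u * (q * t * v * r * w) by move=> *; ring.
congr (_ * _).
rewrite -!big_split /=.
(* The terms 2a + n + j + 1 cancel between the Vandermonde ratio and the triangular determinant;
   what remains in the numerator is (2n)!. *)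
have -> : \prod_(j < n) ((A j)^-1 * ((n + j).+1%:R / (2 * a + (n + j).+1%:R)) *
    ((2 * a + (n + j).+1%:R) * (n - j)%:R)) =
    \prod_(j < n) ((n.+1%:R + j%:R) * (0 + (n - j)%:R)) /
    (\prod_(j < n) (a + 1 + n%:R + j%:R) * \prod_(j < n) (a + (n - j)%:R)).
  rewrite -big_split -prodfV -big_split /=; apply: eq_bigr => j _.
  have := A0 j (ltn_ord j); rewrite /A; have := a2_npos (n + j).
  rewrite add0r -natrD addSn mulf_eq0 negb_or.
  move: ((n + j).+1%:R) ((n - j)%:R) => u v u0 /andP[v0 w0]; field.
  by rewrite u0 w0 [a + 1 + _ + _]addrAC v0.
rewrite big_split /= !rise_rev add0r rise1 -/(rise _ _) -/(rise _ _).
rewrite [rise n.+1%:R n * _]mulrC natrM_fact_rise.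
have p0 : rise (a + 1) n != 0 by apply: (@rise_int_neq0 1).
have pE := phi_rise n.
have q0 : rise (a + 1 + n%:R) n != 0 by apply: (@rise_int_neq0 (1 + n%:Z)); rewrite rmorphD /= addrA.
have r0 : a + 1 + n%:R + n%:R != 0.
  by have := ai (1 + n%:Z + n%:Z); rewrite !rmorphD /= !addrA.
have t0 : rise (a - n%:R + 1) n != 0.
  by apply: (@rise_int_neq0 (1 - n%:Z)); rewrite rmorphB /=; ring.
have -> : phi n%:Z = phi 0 * rise (a - n%:R + 1) n / rise (a + 1) n by rewrite -pE mulfK.
rewrite /th_rows addn0 subn1 /= subr0 -addnn -addnS !riseD [rise (a + 1 + _) n.+1]riseS.
move: (rise (a + 1) n) (rise (a + 1 + _) n) (rise (a - n%:R + 1) n) p0 q0 t0 => p q t p0 q0 t0.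
move: (rise (2 * a + 1) n * _) => w; field.
by rewrite p0 q0 t0 r0.
Qed.

Lemma det_toeplitz_hankel n :
  \det (\matrix_(j < n, k < n) (phi (j%:Z - k%:Z) + phi (j%:Z + k%:Z + 1))) =
  \prod_(m < n) (phi 0 * m.*2`!%:R * rise (2 * a + 1) m.*2.+1 /
     (rise (a + 1) m.*2 * rise (a + 1) m.*2.+1)).
Proof.
rewrite det_th; elim: n => [|n IH]; last by rewrite th_det_step IH big_ord_recr.
by rewrite /th_det /vandermonde_prod !big_ord0 divr1 !mulr1.
Qed.

End ToeplitzHankelDeterminant.

(** * Asymptotics of the products *)

Section ProductAsymptotics.
Variable R : realType.
Implicit Types (z a c : R[i]) (n k m : nat).
Local Open Scope classical_set_scope.

Lemma natrS_neq0 n : (n.+1%:R : R[i]) != 0.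
Proof. by rewrite pnatr_eq0. Qed.

Lemma gamma_prod_rise z n : gamma_prod z n = rise (z + 1) n / n`!%:R.
Proof.
elim: n => [|n IH]; first by rewrite rise0 /gamma_prod big_ord0 fact0 divr1.
rewrite gamma_prodS IH riseS factS natrM.
have f0 : (n`!%:R : R[i]) != 0 by rewrite pnatr_eq0 -lt0n fact_gt0.
move: (n`!%:R) f0 (natrS_neq0 n) => f f0; rewrite -natr1.
by move: (n%:R) => x x0; field; rewrite f0 x0.
Qed.

(** Legendre duplication, factor by factor: in Q(2z) the factors of odd index are those of Q(z -
    1/2) up to a constant free of z, and those of even index are the factors of Q(z). *)
Lemma half_factor z n :
  1 + (z - 1 / 2) / n.+1%:R =
  (1 + - (1 / 2) / n.+1%:R) * (1 + 2 * z / n.*2.+1%:R).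
Proof.
have := natrS_neq0 n; have := natrS_neq0 n.*2.
rewrite -[n.*2.+1%:R]natr1 -[n.+1%:R]natr1 -muln2 natrM.
by move: (n%:R) => x x1 x2; field; rewrite x1 x2.
Qed.

Lemma double_factor z n : 1 + 2 * z / n.*2.+2%:R = 1 + z / n.+1%:R.
Proof.
have := natrS_neq0 n; rewrite -doubleS -muln2 natrM.
by move: (n.+1%:R) => x x1; field; rewrite x1.
Qed.

(* The duplication formula of the Barnes function, at the level of partial products. *)
Lemma barnes_prod_double z n :
  barnes_prod (2 * z) n.*2 * barnes_prod (- (1 / 2)) n ^+ 2 * gamma_prod (2 * z) n.*2 =
  barnes_prod z n ^+ 2 * barnes_prod (z - 1 / 2) n ^+ 2 * gamma_prod z n.
Proof.
elim: n => [|n IH]; first by rewrite /barnes_prod /gamma_prod !big_ord0 !expr1n !mulr1.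
rewrite doubleS !(barnes_prodS, gamma_prodS) half_factor double_factor.
move: IH; move: (barnes_prod (2 * z) _) (barnes_prod (- _) _) (gamma_prod (2 * z) _).
move: (barnes_prod z _) (barnes_prod (z - _) _) (gamma_prod z _).
move: (1 + - (1 / 2) / _) (1 + 2 * z / n.*2.+1%:R) (1 + z / n.+1%:R) => C A B b1 b2 g1 b3 b4 g2 IH.
have -> : A ^+ n.*2.+1 = A ^+ n * A ^+ n * A by rewrite exprSr -addnn exprD.
have -> : B ^+ n.*2.+2 = (B ^+ n * B ^+ n) * B * B by rewrite !exprSr -addnn exprD.
rewrite !exprMn -!exprM !muln2 -!addnn !exprD !exprS !expr0.
move: (A ^+ n) (B ^+ n) (C ^+ n) => An Bn Cn.
transitivity ((b3 * b4 ^+ 2 * g2) * (An * An * A * (Bn * Bn * B * B) * (Cn * C * (Cn * C)) * A * B)).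
  by ring.
by rewrite IH; ring.
Qed.

Definition barnes_ratio a n : R[i] :=
  barnes_prod a n.*2 / barnes_prod a n *
  (barnes_prod (- (1 / 2)) n / barnes_prod (a - 1 / 2) n) *
  (gamma_prod (2 * a) n.*2 / gamma_prod a n).

(** s_n of the overview, with c for phi_0; [barnes_ratio] is the cofactor of s_(2n)^n there. *)
Definition gamma_ratio c a n : R[i] := c * gamma_prod (2 * a) n / gamma_prod a n ^+ 2.

Variable a : R[i].
Hypothesis a_npos : no_neg_int a.
Hypothesis a2_npos : no_neg_int (2 * a).
Hypothesis ah_npos : no_neg_int (a - 1 / 2).
Hypothesis h_npos : no_neg_int (- (1 / 2) : R[i]).

(** Summation by parts in multiplicative form. The k-th factors of Q(2a) and Q(a) are missing from
    about k/2 of the n ratios; extracting s_(2n)^n leaves these multiplicities, linear in k, as the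
    exponents of Barnes products. *)
Lemma prod_gamma_barnes c n :
  \prod_(m < n) (c * m.*2`!%:R * rise (2 * a + 1) m.*2.+1 /
     (rise (a + 1) m.*2 * rise (a + 1) m.*2.+1)) =
  gamma_ratio c a n.*2 ^+ n * barnes_ratio a n.
Proof.
elim: n => [|n IH].
  by rewrite /barnes_ratio /barnes_prod /gamma_prod !big_ord0 !divr1 !mulr1 expr0.
rewrite big_ord_recr /= IH.
have -> : c * n.*2`!%:R * rise (2 * a + 1) n.*2.+1 /
     (rise (a + 1) n.*2 * rise (a + 1) n.*2.+1) =
   c * gamma_prod (2 * a) n.*2.+1 / (gamma_prod a n.*2 * gamma_prod a n.*2.+1).
  rewrite !gamma_prod_rise.
  have f k : (k`!%:R : R[i]) != 0 by rewrite pnatr_eq0 -lt0n fact_gt0.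
  have := gamma_prod_neq0 n.*2 a_npos; have := gamma_prod_neq0 n.*2.+1 a_npos.
  rewrite !gamma_prod_rise !mulf_eq0 !negb_or => /andP[+ _] /andP[+ _].
  move: (f n.*2) (f n.*2.+1); move: (rise _ _) (rise _ _) (rise _ _) => x y w.
  move: (_`!%:R) (_`!%:R) => f1 f2 f10 f20 y0 w0; field.
  by rewrite f10 f20 y0 w0.
rewrite /barnes_ratio /gamma_ratio doubleS !(barnes_prodS, gamma_prodS).
rewrite half_factor double_factor.
have n0 k z : no_neg_int z -> 1 + z / k.+1%:R != 0 by move=> /(_ k).
have := n0 n.*2 _ a_npos; have := n0 n.*2.+1 _ a_npos; have := n0 n.*2 _ a2_npos.
have := n0 n _ a_npos; have := n0 n _ h_npos.
move: (gamma_prod_neq0 n a_npos) (gamma_prod_neq0 n.*2 a_npos).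
move: (barnes_prod_neq0 n a_npos) (barnes_prod_neq0 n ah_npos).
move: (barnes_prod (- _) _) (gamma_prod (2 * a) _) (barnes_prod a n.*2).
move: (barnes_prod a n) (barnes_prod (a - _) _) (gamma_prod a n) (gamma_prod a n.*2).
move: (1 + - (1 / 2) / _) (1 + 2 * a / n.*2.+1%:R) (1 + a / n.+1%:R).
move: (1 + a / n.*2.+1%:R) (1 + a / n.*2.+2%:R).
move=> X Y C A B b1 b2 g1 g2 b3 g3 b4 b10 b20 g10 g20 C0 B0 A0 Y0 X0.
have -> : X ^+ n.*2.+1 = X ^+ n * X ^+ n * X by rewrite exprSr -addnn exprD.
have -> : Y ^+ n.*2.+2 = (Y ^+ n * Y ^+ n) * Y * Y by rewrite !exprSr -addnn exprD.
(* Passing from s_(2n) to s_(2n+2) adds two factors to each product. Powers are split into n-th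
   powers treated as unknowns, which leaves an identity for [field]. *)
have -> : (c * (g3 * A * B) / (g2 * X * Y) ^+ 2) ^+ n.+1 =
  (c * g3 / g2 ^+ 2) ^+ n * (c * g3 / g2 ^+ 2) *
   ((A ^+ n * A) * (B ^+ n * B) / ((X ^+ n * X * (Y ^+ n * Y)) ^+ 2)).
  rewrite (_ : c * (g3 * A * B) / (g2 * X * Y) ^+ 2 =
    (c * g3 / g2 ^+ 2) * ((A * B) * ((X * Y) ^+ 2)^-1)); last first.
    by field; rewrite g20 X0 Y0.
  rewrite exprMn [(c * _ / _) ^+ n.+1]exprSr; congr (_ * _).
  by rewrite exprMn exprVn exprAC [(X * Y) ^+ _]exprMn [(A * B) ^+ _]exprMn ![_ ^+ n.+1]exprSr.
rewrite [(C * A) ^+ _]exprMn ![_ ^+ n.+1]exprSr.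
move: ((c * _ / _) ^+ n) => S.
have := expf_neq0 n X0; have := expf_neq0 n Y0; have := expf_neq0 n A0.
have := expf_neq0 n B0; have := expf_neq0 n C0.
move: (A ^+ n) (B ^+ n) (C ^+ n) (X ^+ n) (Y ^+ n) => An Bn Cn Xn Yn.
move=> Cn0 Bn0 An0 Yn0 Xn0; field.
by rewrite !(b10, b20, g10, g20, C0, B0, A0, Y0, X0, Cn0, Bn0, An0, Yn0, Xn0).
Qed.

End ProductAsymptotics.

(** * Limit and rate of convergence of s_N *)

Section RatioAsymptotics.
Variable R : realType.
Implicit Types (z c : R[i]) (n k m : nat).
Local Open Scope classical_set_scope.

Lemma cvgc_unique (u : nat -> R[i]^o) (l l' : R[i]^o) :
  u @ \oo --> l -> u @ \oo --> l' -> l = l'.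
Proof. by move=> ul ul'; apply: (cvg_unique (@norm_hausdorff _ _) ul ul'). Qed.

Lemma cvgc_eq (u v : nat -> R[i]^o) (l : R[i]^o) :
  (forall n, u n = v n) -> u @ \oo --> l -> v @ \oo --> l.
Proof. by move=> /funext ->. Qed.

Lemma cvgc_invn z : (fun n => 1 + z / n.+1%:R : R[i]^o) @ \oo --> (1 : R[i]^o).
Proof.
apply: (@cvgc_squeeze _ _ _ (fun n => normc z * n.+1%:R^-1)); last exact: cvg_mul_harmonic.
apply: nearW => n; rewrite opprD addrA subrr sub0r normcN normcM normcV.
by rewrite (normc_nat R n.+1).
Qed.

Variables (a c : R[i]).
Hypothesis a_npos : no_neg_int a.
Hypothesis a2_npos : no_neg_int (2 * a).
Hypothesis c_cvg :
  (fun n => c * gamma_prod (2 * a) n.*2 / gamma_prod a n ^+ 2 : R[i]^o) @ \oo -->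
  (cexp ((ln 2)%:C * (2 * a)) : R[i]^o).

(** A limit exists because the normalisations n^(2a) and (n^a)^2 cancel. Multiplying s_n by
    Q_(2n)(2a) / Q_n(2a), which tends to 4^a, gives the sequence of [c_cvg], also of limit 4^a; so
    the limit is 1. *)
Lemma gamma_ratio_cvg1 : (gamma_ratio c a : nat -> R[i]^o) @ \oo --> (1 : R[i]^o).
Proof.
have [l1 l10 u1] := gamma_prod_cvg a_npos; have [l2 l20 u2] := gamma_prod_cvg a2_npos.
have sL : (gamma_ratio c a : nat -> R[i]^o) @ \oo --> (c * (l2 * (l1 ^+ 2)^-1) : R[i]^o).
  have l12 : l1 ^+ 2 != 0 by rewrite expf_neq0.
  have := cvgcMl (c := c) (cvgcM u2 (cvgcV l12 (cvgcX (k := 2) u1))).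
  apply: cvgc_eq => n; rewrite /gamma_ratio.
  have -> : - ((ln n.+1%:R)%:C * (2 * a)) =
     - ((ln n.+1%:R)%:C * a) + - ((ln n.+1%:R)%:C * a) :> R[i] by ring.
  rewrite cexpD; have := cexp_neq0 (- ((ln n.+1%:R)%:C * a)).
  have := gamma_prod_neq0 n a_npos.
  move: (cexp _) (gamma_prod a n) (gamma_prod _ n) => e q p q0 e0; field.
  by rewrite q0 e0.
have := cvgcM sL (gamma_prod_double a2_npos).
move=> /(@cvgc_eq _ (fun n => c * gamma_prod (2 * a) n.*2 / gamma_prod a n ^+ 2)) H.
have {}H := cvgc_unique c_cvg (H _).
rewrite (_ : c * (l2 * _) = 1) in sL; first exact: sL.
apply: (mulIf (cexp_neq0 ((ln 2)%:C * (2 * a)))); rewrite mul1r -H// => n.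
rewrite /gamma_ratio; move: (gamma_prod_neq0 n a_npos) (gamma_prod_neq0 n a2_npos).
move: (gamma_prod a n) (gamma_prod _ n) (gamma_prod _ _) => p q r p0 q0; field.
by rewrite p0 q0.
Qed.

Lemma gamma_ratio_rate :
  (fun n => n.+1%:R * (gamma_ratio c a n - 1) : R[i]^o) @ \oo --> (a ^+ 2 : R[i]^o).
Proof.
apply: stolz; first exact: gamma_ratio_cvg1.
have one2 : (1 : R[i]^o) ^+ 2 != 0 by rewrite expr1n oner_eq0.
(* With x = n + 1 one has exactly s_n - s_(n+1) = s_n (a/x)^2 / (1 + a/x)^2. *)
have := cvgcMl (c := a ^+ 2) (cvgcM gamma_ratio_cvg1
  (cvgcM (cvgc_invn 1) (cvgcV one2 (cvgcX (k := 2) (cvgc_invn a))))).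
have -> : a ^+ 2 * (1 * (1 * (1 ^+ 2)^-1)) = a ^+ 2 by rewrite expr1n invr1 !mulr1.
apply: cvgc_eq => n; rewrite /gamma_ratio !gamma_prodS.
move: (gamma_prod_neq0 n a_npos) (a_npos n) (natrS_neq0 R n).
rewrite -[n.+2%:R]natr1.
move: (gamma_prod a n) (gamma_prod _ n) (n.+1%:R) => p q x p0 ax x0.
have xa : x + a != 0.
  by move: ax; apply: contraNneq => xa; rewrite -[1](divff x0) -mulrDl xa mul0r.
by field; rewrite p0 x0 xa.
Qed.

Lemma gamma_ratio_exp :
  (fun n => gamma_ratio c a n.*2 ^+ n : R[i]^o) @ \oo --> (cexp (a ^+ 2 / 2) : R[i]^o).
Proof.
apply: (@cvgc_exprn _ (fun n => gamma_ratio c a n.*2)).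
have r2 : (fun n => n.*2.+1%:R * (gamma_ratio c a n.*2 - 1) : R[i]^o) @ \oo --> (a ^+ 2 : R[i]^o).
  by apply: (cvg_comp _ (fun n => n.+1%:R * (gamma_ratio c a n - 1) : R[i]^o) cvg_double gamma_ratio_rate).
(* This is n/(2n + 1), which turns the rate at index 2n into one relative to the exponent n. *)
have h1 : (fun n => 2^-1 * (1 + (-1) / n.*2.+1%:R) : R[i]^o) @ \oo --> (2^-1 * 1 : R[i]^o).
  apply: cvgcMl.
  by apply: (cvg_comp _ (fun n => 1 + (-1) / n.+1%:R : R[i]^o) cvg_double (cvgc_invn _)).
have := cvgcM r2 h1; rewrite [2^-1 * 1]mulr1; apply: cvgc_eq => n.
move: (gamma_ratio _ _ _) (natrS_neq0 R n.*2) => s.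
rewrite -[n.*2.+1%:R]natr1 -muln2 natrM; move: (n%:R) => x x0; field.
by rewrite x0.
Qed.

End RatioAsymptotics.

(** * Assembly of the Barnes functions *)

Section MainAsymptotics.
Variable R : realType.
Implicit Types (z : R[i]) (n : nat).
Local Open Scope classical_set_scope.

Lemma cpowE (x : R) z : 0 < x -> cpow x z = cexp (z * (ln x)%:C).
Proof. by move=> x0; rewrite /cpow gt_eqF. Qed.

Variables (a c : R[i]).
Hypothesis a_npos : no_neg_int a.
Hypothesis a2_npos : no_neg_int (2 * a).
Hypothesis ah_npos : no_neg_int (a - 1 / 2).
Hypothesis h_npos : no_neg_int (- (1 / 2) : R[i]).
Hypothesis c_cvg :
  (fun n => c * gamma_prod (2 * a) n.*2 / gamma_prod a n ^+ 2 : R[i]^o) @ \oo -->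
  (cexp ((ln 2)%:C * (2 * a)) : R[i]^o).

(** The duplication formula eliminates the Q products. Among the exponentials of [barnes_norm] the
    terms linear in n cancel; the rest gives the powers of n and 2 and the factor e^(-a^2/2), which
    the limit of s_(2n)^n compensates. *)
Lemma barnes_ratio_norm n : (0 < n)%N ->
  barnes_ratio a n =
  cexp ((a ^+ 2 + a) / 2 * (ln n%:R)%:C) * cexp (3 * a ^+ 2 / 2 * (ln 2)%:C) *
  (barnes_norm (a - 1 / 2) n * barnes_norm a n ^+ 2 /
    (barnes_norm (- (1 / 2)) n * barnes_norm (2 * a) n.*2) *
   (barnes_norm a n.*2 / barnes_norm a n) * cexp (- (a ^+ 2 / 2))).
Proof.
move=> n0; rewrite /barnes_norm /barnes_ratio.
have -> : ln n.*2%:R = ln n%:R + ln 2 :> R.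
  by rewrite -muln2 natrM lnM ?posrE ?ltr0n.
rewrite rmorphD /= -muln2 natrM muln2; set L := (ln n%:R)%:C; set l := (ln 2)%:C.
have d := barnes_prod_double a n.
have b1 := barnes_prod_neq0 n a_npos; have b2 := barnes_prod_neq0 n ah_npos.
have b3 := barnes_prod_neq0 n h_npos; have b4 := barnes_prod_neq0 n.*2 a2_npos.
have q1 := gamma_prod_neq0 n a_npos.
have -> : gamma_prod (2 * a) n.*2 = barnes_prod a n ^+ 2 * barnes_prod (a - 1 / 2) n ^+ 2 *
   gamma_prod a n / (barnes_prod (2 * a) n.*2 * barnes_prod (- (1 / 2)) n ^+ 2).
  by rewrite -d; field; rewrite b3 b4.
set x := n%:R.
set A := - _ + _ - _; set B := - _ + _ - _; set C := - _ + _ - _.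
set D := - _ + _ - _; set E := - _ + _ - _.
have e : cexp ((a ^+ 2 + a) / 2 * L) * cexp (3 * a ^+ 2 / 2 * l) *
   (cexp A * cexp B ^+ 2 / (cexp C * cexp D) * (cexp E / cexp B) * cexp (- (a ^+ 2 / 2))) = 1.
  rewrite -(cexpMn B 2) -(cexpD C) -!cexpN -!cexpD -[RHS](@cexp0 R); congr cexp.
  by rewrite /A /B /C /D /E; field.
move: e; have := cexp_neq0 B; have := cexp_neq0 C; have := cexp_neq0 D.
move: (cexp _) (cexp _) (cexp _) (cexp A) (cexp B) (cexp C) (cexp D) (cexp E).
move: b1 b2 b3 b4 q1 {d}.
move: (barnes_prod a n) (barnes_prod (a - _) n) (barnes_prod (- _) n) (barnes_prod (2 * a) _)
 (gamma_prod a n) (barnes_prod a n.*2).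
move=> p1 p2 p3 p4 p5 p6 p10 p20 p30 p40 p50 e1 e2 e3 eA eB eC eD eE eD0 eC0 eB0 H.
transitivity (p6 / p1 * (p1 ^+ 2 * p2 / (p4 * p3))); first by field; rewrite p10 p20 p30 p40 p50.
rewrite -[LHS]mulr1 -H; field.
by rewrite p10 p30 p40 eB0 eC0 eD0.
Qed.

Lemma asymp_equiv_lim (u v k : nat -> R[i]) (w : nat -> R[i]^o) (W : R[i]^o) :
  W != 0 -> w @ \oo --> W ->
  (forall n, (0 < n)%N -> u n = k n * w n) -> (forall n, (0 < n)%N -> v n = k n * W) ->
  asymp_equiv u v.
Proof.
move=> W0 wW uE vE; exists (fun n => w n / W - 1).
  have hW : (fun=> W^-1 : R[i]^o) @ \oo --> (W^-1 : R[i]^o) by exact: cvg_cst.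
  have h1 : (fun=> 1 : R[i]^o) @ \oo --> (1 : R[i]^o) by exact: cvg_cst.
  have H := cvgB (cvgcM wW hW) h1.
  have W1 : W * W^-1 - 1 = 0 by rewrite mulfV// subrr.
  by rewrite W1 in H; exact: H.
near=> n; have n0 : (0 < n)%N by near: n; exact: nbhs_infty_gt.
rewrite uE// vE// -mulrA; congr (_ * _).
by rewrite addrC subrK mulrC divfK.
Unshelve. all: by end_near. Qed.

Lemma asymp_equiv_barnes :
  asymp_equiv
    (fun n : nat => gamma_ratio c a n.*2 ^+ n * barnes_ratio a n)
    (fun n : nat =>
       cpow n%:R ((a ^+ 2 + a) / 2) *
       cpow (2 * pi) (- (a / 2)) *
       cpow 2 (3 * a ^+ 2 / 2) *
       (barnesG (1 / 2 + a) * barnesG (1 + a) ^+ 2 /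
        (barnesG (1 / 2) * barnesG (1 + 2 * a)))).
Proof.
have [g1 [g10 u1 E1]] := barnes_norm_cvg a_npos.
have [g2 [g20 u2 E2]] := barnes_norm_cvg a2_npos.
have [g3 [g30 u3 E3]] := barnes_norm_cvg ah_npos.
have [g4 [g40 u4 E4]] := barnes_norm_cvg h_npos.
have -> : 1 / 2 + a = 1 + (a - 1 / 2) by field.
have -> : barnesG (1 / 2 : R[i]) = barnesG (1 + - (1 / 2)) by congr barnesG; field.
pose W := g3 * g1 ^+ 2 / (g4 * g2).
have W0 : W != 0 by rewrite !mulf_neq0 ?expf_neq0 ?invr_neq0 ?mulf_neq0.
pose w n : R[i]^o := gamma_ratio c a n.*2 ^+ n *
  (barnes_norm (a - 1 / 2) n * barnes_norm a n ^+ 2 /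
    (barnes_norm (- (1 / 2)) n * barnes_norm (2 * a) n.*2) *
   (barnes_norm a n.*2 / barnes_norm a n) * cexp (- (a ^+ 2 / 2))).
have wW : w @ \oo --> (W : R[i]^o).
  have g420 : g4 * g2 != 0 by rewrite mulf_neq0.
  have u22 : (fun n => barnes_norm (2 * a) n.*2 : R[i]^o) @ \oo --> g2.
    by apply: (cvg_comp _ (fun n => barnes_norm (2 * a) n : R[i]^o) cvg_double u2).
  have h1 := cvgcM (cvgcM u3 (cvgcX (k := 2) u1)) (cvgcV g420 (cvgcM u4 u22)).
  have h2 := cvgc_double_ratio g10 u1.
  have hc : (fun=> cexp (- (a ^+ 2 / 2)) : R[i]^o) @ \oo --> (cexp (- (a ^+ 2 / 2)) : R[i]^o).
    exact: cvg_cst.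
  have := cvgcM (gamma_ratio_exp a_npos a2_npos c_cvg) (cvgcM (cvgcM h1 h2) hc).
  rewrite (_ : cexp _ * _ = W) => [|]; first exact.
  rewrite mulr1 cexpN mulrC mulfVK ?cexp_neq0//.
apply: (asymp_equiv_lim (k := fun n => cexp ((a ^+ 2 + a) / 2 * (ln n%:R)%:C) *
    cexp (3 * a ^+ 2 / 2 * (ln 2)%:C)) W0 wW) => n n0.
  by rewrite barnes_ratio_norm// mulrCA.
have pi2 : 0 < 2 * pi :> R by rewrite mulr_gt0 ?pi_gt0.
rewrite E1 E2 E3 E4 !(cpowE _ pi2) !cpowE ?ltr0n//.
set P := (ln (2 * pi))%:C.
(* The powers of 2 pi contained in the four Barnes functions cancel the explicit (2 pi)^(-a/2). *)
have eP : cexp (- (a / 2) * P) * (cexp ((a - 1 / 2) / 2 * P) * cexp (a / 2 * P) ^+ 2 /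
   (cexp (- (1 / 2) / 2 * P) * cexp (2 * a / 2 * P))) = 1.
  rewrite -(cexpMn _ 2) -(cexpD (- (1 / 2) / 2 * P)) -!cexpN -!cexpD -[RHS](@cexp0 R); congr cexp.
  by field.
move: eP (cexp_neq0 (- (1 / 2) / 2 * P)) (cexp_neq0 (2 * a / 2 * P)).
rewrite /W.
move: (cexp (- (a / 2) * P)) (cexp ((a - 1 / 2) / 2 * P)) (cexp (a / 2 * P)).
move: (cexp (- (1 / 2) / 2 * P)) (cexp (2 * a / 2 * P)).
move: (cexp _) (cexp _).
move: g10 g20 g30 g40; clear.
move=> g10 g20 g30 g40 K1 K2 q3 q4 p q1 q2 eP q30 q40.
transitivity (K1 * K2 * (g3 * g1 ^+ 2 / (g4 * g2)) * (p * (q1 * q2 ^+ 2 / (q3 * q4)))).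
  by field; rewrite !(g10, g20, g30, g40, q30, q40).
by rewrite eP mulr1 [K1 * K2]mulrC.
Qed.

End MainAsymptotics.

(** * Improper integrals *)

Section ImproperIntegral.
Variable R : realType.
Local Notation mu := (@lebesgue_measure R).
Implicit Types (f F : R -> R) (a b x : R).
Local Open Scope classical_set_scope.

Lemma integrable_oo_cc f a b :
  mu.-integrable `]a, b[ (EFin \o f) -> mu.-integrable `[a, b] (EFin \o f).
Proof.
move=> /integrableP[mf foo]; apply/integrableP; split.
  by apply/measurable_EFinP; apply: measurable_fun_itv_cc; apply/measurable_EFinP; exact: mf.
have mf1 : measurable_fun `]a, b[ (fun x => `|(EFin \o f) x|%E).
  exact: measurableT_comp mf.
have mf2 : measurable_fun `[a, b[ (fun x => `|(EFin \o f) x|%E).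
  apply: measurableT_comp => //; apply/measurable_EFinP.
  by apply: measurable_fun_itv_co; apply/measurable_EFinP; exact: mf.
by rewrite -integral_itv_bndo_bndc// -integral_itv_obnd_cbnd.
Qed.

Lemma Rintegral_oo_cc f a b : mu.-integrable `]a, b[ (EFin \o f) ->
  (\int[mu]_(x in `]a, b[) f x)%R = (\int[mu]_(x in `[a, b]) f x)%R.
Proof.
move=> fi; have fc := integrable_oo_cc fi.
rewrite Rintegral_itv_obnd_cbnd// Rintegral_itv_bndo_bndc//.
by apply: integrableS fc => //; apply: subset_itvl; rewrite bnd_simp.
Qed.

Lemma integrable_itv_cat f a b c : a < b -> b < c ->
  mu.-integrable `]a, b[ (EFin \o f) -> mu.-integrable `]b, c[ (EFin \o f) ->
  (\int[mu]_(x in `[a, c]) f x)%R =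
  (\int[mu]_(x in `]a, b[) f x)%R + (\int[mu]_(x in `]b, c[) f x)%R.
Proof.
move=> ab bc f1 f2.
have c1 : mu.-integrable `[a, b[ (EFin \o f).
  by apply: integrableS (integrable_oo_cc f1) => //; apply: subset_itvl; rewrite bnd_simp.
have c2 := integrable_oo_cc f2.
have U : `[a, c]%classic = `[a, b[ `|` `[b, c].
  by apply: itv_bndbnd_setU; rewrite bnd_simp ltW.
have disj : [disjoint `[a, b[ & `[b, c]].
  apply/eqP; rewrite -subset0 => x [] /=; rewrite !in_itv /= => /andP[_ xb] /andP[bx _].
  by move: (lt_le_trans xb bx); rewrite ltxx.
have cU : mu.-integrable (`[a, b[ `|` `[b, c]) (EFin \o f).
  move/integrableP : c1 => [m1 i1]; move/integrableP : c2 => [m2 i2].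
  apply/integrableP; split; first exact/measurable_funU.
  rewrite ge0_integral_setU//; first exact: lte_add_pinfty.
  by apply: measurableT_comp => //; apply/measurable_funU.
rewrite U Rintegral_setU//; congr (_ + _).
  by rewrite Rintegral_itv_obnd_cbnd.
by rewrite Rintegral_oo_cc.
Qed.

(** Over compact subintervals exhausting ]a, b[ the integral is an increment of F, at most 2M;
    monotone convergence then applies because f >= 0. *)
Lemma integrable_antiderivative f F a b M : a < b ->
  (forall x, a < x < b -> 0 <= f x) ->
  (forall x, a < x < b -> {for x, continuous f}) ->
  (forall x, a < x < b -> is_derive x 1 F (f x)) ->
  (forall x, a < x < b -> `|F x| <= M) ->
  mu.-integrable `]a, b[ (EFin \o f).
Proof.
move=> ab f0 fc Fd FM.
have mf : measurable_fun `]a, b[ f.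
  apply: open_continuous_measurable_fun; first exact: interval_open.
  by move=> x /set_mem /= xab; apply: fc; move: xab; rewrite in_itv.
apply/integrableP; split; first exact/measurable_EFinP.
have -> : (\int[mu]_(x in `]a, b[) `|(EFin \o f) x| = \int[mu]_(x in `]a, b[) (EFin \o f) x)%E.
  by apply: eq_integral => x; rewrite inE /= in_itv /= => /f0 fx; rewrite ger0_norm.
(* A third of the length keeps l_n < r_n already for n = 0. *)
pose e := (b - a) / 3.
have e0 : 0 < e by rewrite divr_gt0// subr_gt0.
pose l n := a + e * n.+1%:R^-1.
pose r n := b - e * n.+1%:R^-1.
have n1 n : 0 < n.+1%:R^-1 :> R by rewrite invr_gt0.
have n1' n : n.+1%:R^-1 <= 1 :> R by rewrite invf_le1 ?ler1n.
have en n : 0 < e * n.+1%:R^-1 <= e by rewrite mulr_gt0//= ler_piMr// ltW.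
have lr n : l n < r n.
  by have := en n; rewrite /l /r; move: (e * _) => t /andP[_]; rewrite /e; lra.
have al n : a < l n by have := en n; rewrite /l; move: (e * _) => t /andP[]; lra.
have rb n : r n < b by have := en n; rewrite /r; move: (e * _) => t /andP[]; lra.
pose G n := `[l n, r n]%classic.
have Gab n x : G n x -> a < x < b.
  rewrite /G /= in_itv /= => /andP[lx xr].
  by rewrite (lt_le_trans (al n))// (le_lt_trans xr).
have UG : `]a, b[%classic = \bigcup_n G n.
  apply/seteqP; split; last by move=> x [n _ /Gab]; rewrite /= in_itv.
  move=> x /=; rewrite in_itv /= => /andP[ax xb].
  have ha := cvg_mul_harmonic e.
  have d0 : 0 < Num.min (x - a) (b - x) by rewrite lt_min !subr_gt0 ax.
  have /cvgrPdist_le/(_ _ d0)[N _ /(_ N (leqnn N))] := ha.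
  rewrite /= sub0r normrN ger0_norm; last by case/andP: (en N) => /ltW.
  rewrite le_min => /andP[h1 h2].
  exists N => //; rewrite /G /= in_itv /= /l /r.
  by rewrite -lerBrDl h1/= lerBrDl addrC -lerBrDl.
have ndG : nondecreasing_seq G.
  apply/nondecreasing_seqP => n; rewrite subsetEset => x; rewrite /G /= !in_itv /=.
  have : e * n.+2%:R^-1 <= e * n.+1%:R^-1.
    by rewrite ler_wpM2l ?(ltW e0)// lef_pV2 ?posrE// ler_nat.
  rewrite /l /r; move: (e * _) (e * _) => t1 t2 h /andP[h1 h2]; apply/andP; split; lra.
rewrite UG; apply: (@le_lt_trans _ _ (2 * M)%:E); last by rewrite ltry.
apply: (@cvge_le _ \oo _ _ (fun n => (\int[mu]_(x in G n) (EFin \o f) x)%E)); last first.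
  apply: ge0_nondecreasing_set_cvg_integral => [|n|n|n x Gx]; first exact: ndG.
    - exact: measurable_itv.
    - by apply/measurable_EFinP; apply: measurable_funS mf => // y /Gab; rewrite /= in_itv.
    - by rewrite lee_fin; apply: f0; exact: Gab Gx.
apply: nearW => n.
have lin : a < l n < b by apply: (Gab n); rewrite /G /= in_itv /= lexx ltW.
have rin : a < r n < b by apply: (Gab n); rewrite /G /= in_itv /= lexx ltW.
have Fder x : a < x < b -> derivable F x 1 by move=> /Fd[].
have Fcon x : a < x < b -> {for x, continuous F}.
  by move=> /Fder /derivable1_diffP/differentiable_continuous.
rewrite (@continuous_FTC2 _ f F (l n) (r n)); first last.
- move=> x xlr; have xab : a < x < b.
    by apply: (Gab n); apply: subset_itv_oo_cc xlr.
  by rewrite derive1E; case: (Fd x xab).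
- split.
  + move=> x xlr; apply: Fder; apply: (Gab n); apply: subset_itv_oo_cc xlr.
  + by apply: cvg_at_right_filter; exact: Fcon.
  + by apply: cvg_at_left_filter; exact: Fcon.
- apply: continuous_in_subspaceT => x; rewrite inE => /Gab; exact: fc.
- exact: lr.
rewrite -EFinB lee_fin.
by have := FM _ lin; have := FM _ rin; rewrite !ler_norml => /andP[_ h1] /andP[h2 _]; lra.
Qed.

(** Here f may be unbounded at the endpoints. The indefinite integral minus F is continuous on
    [a, b] with zero derivative inside, hence has equal values at a and b. *)
Lemma Rintegral_improper f F a b : a < b ->
  mu.-integrable `]a, b[ (EFin \o f) ->
  {within `[a, b], continuous F} ->
  (forall x, a < x < b -> {for x, continuous f}) ->
  (forall x, a < x < b -> is_derive x 1 F (f x)) ->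
  (\int[mu]_(x in `]a, b[) f x)%R = F b - F a.
Proof.
move=> ab fo Fc fc Fd; have fi := integrable_oo_cc fo; rewrite Rintegral_oo_cc//.
pose P x := parameterized_integral mu a x f.
have Pc : {within `[a, b], continuous P} := parameterized_integral_continuous (ltW ab) fi.
have Pa : P a = 0 by rewrite /P /parameterized_integral set_itv1 Rintegral_set1.
have Hd x : x \in `]a, b[%R -> is_derive x 1 (P - F) 0.
  rewrite in_itv /= => xab; have xd := Fd x xab; have /andP[ax xb] := xab.
  have [Pd PE] := continuous_FTC1_closed xb fi ax (fc x xab).
  have P' : is_derive x 1 P (f x) by apply: DeriveDef; [exact: Pd|rewrite -derive1E; exact: PE].
  by rewrite -(subrr (f x)); exact: is_deriveB.
have Hc : {within `[a, b], continuous (P - F)}.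
  by move=> x; apply: cvgB; [exact: Pc|exact: Fc].
have [c _] := MVT ab Hd Hc; rewrite mul0r => /eqP.
by rewrite subr_eq0 !fctE Pa sub0r => /eqP; rewrite -/(parameterized_integral mu a b f) -/(P b); lra.
Qed.

End ImproperIntegral.

Section ComplexIntegral.
Variable R : realType.
Local Notation mu := (@lebesgue_measure R).
Implicit Types (f g : R -> R[i]) (D : set (measurableTypeR R)) (a b t : R) (c : R[i]).
Local Open Scope classical_set_scope.

Definition cint D f : R[i] :=
  (\int[mu]_(t in D) complex.Re (f t))%R +i* (\int[mu]_(t in D) complex.Im (f t))%R.

Definition cintegrable D f :=
  mu.-integrable D (EFin \o (fun t => complex.Re (f t))) /\
  mu.-integrable D (EFin \o (fun t => complex.Im (f t))).

Definition ccontinuous t f :=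
  {for t, continuous (fun s => complex.Re (f s))} /\
  {for t, continuous (fun s => complex.Im (f s))}.

Lemma is_cderive_continuous t f d : is_cderive t f d -> ccontinuous t f.
Proof.
move=> [[d1 _] [d2 _]]; split.
  by apply: differentiable_continuous; apply/derivable1_diffP; exact: d1.
by apply: differentiable_continuous; apply/derivable1_diffP; exact: d2.
Qed.

Lemma RintegrableD D (u v : R -> R) : measurable D ->
  mu.-integrable D (EFin \o u) -> mu.-integrable D (EFin \o v) ->
  mu.-integrable D (EFin \o (fun t => u t + v t)).
Proof.
move=> mD iu iv; apply: (eq_integrable mD (fun t => (u t)%:E + (v t)%:E)%E) => [t _|].
  by rewrite /= EFinD.
exact: integrableD.
Qed.

Lemma RintegrableZ D (r : R) (u : R -> R) : measurable D ->
  mu.-integrable D (EFin \o u) -> mu.-integrable D (EFin \o (fun t => r * u t)).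
Proof.
move=> mD iu; apply: (eq_integrable mD (fun t => r%:E * (u t)%:E)%E) => [t _|].
  by rewrite /= EFinM.
exact: integrableZl.
Qed.

Lemma cintegrableD D f g : measurable D -> cintegrable D f -> cintegrable D g ->
  cintegrable D (fun t => f t + g t).
Proof.
move=> mD [f1 f2] [g1 g2]; split.
  by under eq_fun do rewrite ReD; exact: RintegrableD.
by under eq_fun do rewrite ImD; exact: RintegrableD.
Qed.

Lemma cintegrableZ D c f : measurable D -> cintegrable D f ->
  cintegrable D (fun t => c * f t).
Proof.
move=> mD [f1 f2]; split.
  under eq_fun do rewrite ReM -mulNr.
  by apply: RintegrableD => //; exact: RintegrableZ.
under eq_fun do rewrite ImM.
by apply: RintegrableD => //; exact: RintegrableZ.
Qed.

Lemma cintD D f g : measurable D -> cintegrable D f -> cintegrable D g ->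
  cint D (fun t => f t + g t) = cint D f + cint D g.
Proof.
move=> mD [f1 f2] [g1 g2]; apply: complex_eq => /=.
  by under eq_Rintegral do rewrite ReD; rewrite RintegralD.
by under eq_Rintegral do rewrite ImD; rewrite RintegralD.
Qed.

Lemma cintZ D c f : measurable D -> cintegrable D f ->
  cint D (fun t => c * f t) = c * cint D f.
Proof.
move=> mD [f1 f2]; apply: complex_eq; rewrite ?ReM ?ImM /=.
  under eq_Rintegral do rewrite ReM -mulNr.
  by rewrite RintegralD ?RintegralZl ?mulNr//; exact: RintegrableZ.
under eq_Rintegral do rewrite ImM.
by rewrite RintegralD ?RintegralZl//; exact: RintegrableZ.
Qed.

Lemma eq_cint D f g : (forall t, D t -> f t = g t) -> cint D f = cint D g.
Proof.
by move=> fg; congr (_ +i* _); apply: eq_Rintegral => t; rewrite inE => /fg ->.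
Qed.

Lemma normc_cint_le D f (g : R -> R) : measurable D -> cintegrable D f ->
  mu.-integrable D (EFin \o g) -> (forall t, D t -> normc (f t) <= g t) ->
  normc (cint D f) <= (\int[mu]_(t in D) g t)%R.
Proof.
move=> mD fi gi fg; apply: normc_le_phase => u u1.
rewrite -cintZ//=; apply: le_Rintegral => //.
  by case: (cintegrableZ u mD fi).
move=> t /fg; apply: le_trans; apply: le_trans (Re_le_normc _) _.
by rewrite normcM u1 mul1r.
Qed.

Lemma cintegrable_oo a b f (g : R -> R) :
  (forall t, a < t < b -> ccontinuous t f) ->
  (forall t, a < t < b -> normc (f t) <= g t) ->
  mu.-integrable `]a, b[ (EFin \o g) -> cintegrable `]a, b[ f.
Proof.
move=> fc fg gi.
have main (h : R -> R) : (forall t, a < t < b -> {for t, continuous h}) ->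
    (forall t, `|h t| <= normc (f t)) -> mu.-integrable `]a, b[ (EFin \o h).
  move=> hc hf.
  have mh : measurable_fun `]a, b[ h.
    apply: open_continuous_measurable_fun; first exact: interval_open.
    by move=> x /set_mem /= xab; apply: hc; move: xab; rewrite in_itv.
  apply: le_integrable gi => //; first exact/measurable_EFinP.
  move=> t /=; rewrite in_itv /= => tab; rewrite lee_fin.
  apply: le_trans (hf t) _; apply: le_trans (fg t tab) _; exact: ler_norm.
split; apply: main.
- by move=> t /fc[].
- by move=> t; exact: le_Re_normc.
- by move=> t /fc[].
- by move=> t; exact: le_Im_normc.
Qed.

Lemma cint_improper f F a b : a < b ->
  cintegrable `]a, b[ f ->
  (forall t, a <= t <= b -> ccontinuous t F) ->
  (forall t, a < t < b -> ccontinuous t f) ->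
  (forall t, a < t < b -> is_cderive t F (f t)) ->
  cint `]a, b[ f = F b - F a.
Proof.
move=> ab [f1 f2] Fc fc Fd; apply: complex_eq; rewrite /= ?ReB ?ImB.
- apply: (Rintegral_improper (F := fun t => complex.Re (F t))) => //.
  + apply: continuous_in_subspaceT => t /set_mem /=; rewrite in_itv /=.
    by move=> /Fc[].
  + by move=> t /fc[].
  + by move=> t /Fd[].
- apply: (Rintegral_improper (F := fun t => complex.Im (F t))) => //.
  + apply: continuous_in_subspaceT => t /set_mem /=; rewrite in_itv /=.
    by move=> /Fc[].
  + by move=> t /fc[].
  + by move=> t /Fd[].
Qed.

End ComplexIntegral.

(** * Fourier coefficients of the symbol *)

Section Kernel.
Variable R : realType.
Local Notation mu := (@lebesgue_measure R).
Implicit Types (t s b : R) (z w : R[i]) (k : int).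
Local Open Scope classical_set_scope.

Definition cosym t : R := 2 + 2 * cos t.

Lemma cosym_ge0 t : 0 <= cosym t.
Proof. by have := cos_geN1 t; rewrite /cosym; lra. Qed.

Lemma cosym_le4 t : cosym t <= 4.
Proof. by have := cos_le1 t; rewrite /cosym; lra. Qed.

Lemma ln_cosym_le4 t : 0 < cosym t -> ln (cosym t) <= ln 4.
Proof. by move=> X0; rewrite ler_ln ?posrE// cosym_le4. Qed.

Lemma sin2_cosym t : sin t ^+ 2 = cosym t * (1 - cosym t / 4).
Proof. by rewrite sin2cos2 /cosym; field. Qed.

Lemma cosym_gt0 t : sin t != 0 -> 0 < cosym t.
Proof.
move=> s0; rewrite lt_neqAle cosym_ge0 andbT eq_sym; apply: contraNneq s0 => X0.
by rewrite -sqrf_eq0 sin2_cosym X0 mul0r.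
Qed.

Lemma is_derive_cosym t : is_derive t 1 cosym (- (2 * sin t)).
Proof. by apply: is_derive_eq; rewrite /GRing.scale /=; ring. Qed.

Lemma is_derive_ln_cosym t : 0 < cosym t ->
  is_derive t 1 (fun s => ln (cosym s)) (- (2 * sin t) / cosym t).
Proof.
move=> X0; have d := is_derive_cosym t.
have := @is_derive1_comp _ (@ln R) cosym t _ _ (is_derive1_ln X0) d.
by rewrite mulrC.
Qed.

(* The integrand X^z e^(-ikt) of the Fourier coefficients, where X = 2 + 2 cos t; at X = 0
   it has modulus 1, since [ln 0 = 0]. *)
Definition kern z k t : R[i] :=
  cexp (z * (ln (cosym t))%:C - 'i * k%:~R * t%:C).

Lemma intr_complex k : (k%:~R : R)%:C = k%:~R :> R[i].
Proof. by rewrite rmorph_int. Qed.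

Lemma Re_i_real k t : complex.Re ('i * k%:~R * t%:C : R[i]) = 0.
Proof. by rewrite -intr_complex -mulrA -rmorphM /= !(mul0r, mulr0, subr0). Qed.

Lemma normc_kern z k t : normc (kern z k t) = expR (complex.Re z * ln (cosym t)).
Proof. by rewrite normc_cexp ReB Re_i_real subr0 ReM /= mulr0 subr0. Qed.

Lemma kernS z k t : kern z k t = kern z (k + 1) t * cexp ('i * t%:C).
Proof. by rewrite /kern -cexpD; congr cexp; rewrite rmorphD /=; ring. Qed.

Lemma cexp_i t : cexp ('i * t%:C) = cos t +i* sin t :> R[i].
Proof. exact: cisE. Qed.

Lemma is_cderive_kern z k t : 0 < cosym t ->
  is_cderive t (kern z k)
   ((z * (- (2 * sin t) / cosym t)%:C - 'i * k%:~R) * kern z k t).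
Proof.
move=> X0; apply: is_cderive_cexp.
have d1 := is_cderiveM (is_cderive_cst t z) (is_cderive_real (is_derive_ln_cosym X0)).
have d2 := is_cderiveM (is_cderive_cst t ('i * k%:~R)) (is_cderive_real (is_derive_id t (1 : R))).
have := is_cderiveD d1 (is_cderiveN d2).
by rewrite !mul0r !add0r mulr1.
Qed.

Lemma kern_continuous z k t : 0 < cosym t -> ccontinuous t (kern z k).
Proof. by move=> X0; apply: is_cderive_continuous (is_cderive_kern z k X0). Qed.

(* X^z (1 + e^(it)) e^(-i(k+1)t); its two terms cancel at X = 0, so that it is continuous there. *)
Definition kprim z k t := kern z (k + 1) t + kern z k t.
Definition kprim' z k t :=
  'i * (z - k%:~R) * kern z k t + - ('i * (z + 1 + k%:~R)) * kern z (k + 1) t.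

Lemma is_cderive_kprim z k t : 0 < cosym t ->
  is_cderive t (kprim z k) (kprim' z k t).
Proof.
move=> X0; apply: is_cderive_eq
  (is_cderiveD (is_cderive_kern z (k + 1) X0) (is_cderive_kern z k X0)) _.
rewrite /kprim' [kern z k t]kernS cexp_i; set K := kern z (k + 1) t.
set d := (- (2 * sin t) / cosym t)%:C; set E := cos t +i* sin t.
(* The factor 1 + e^(it) removes the pole of the logarithmic derivative of X, so the derivative is a
   combination of two kernels with constant coefficients. *)
have dE : d * (1 + E) = 'i * (E - 1).
  have Xn : cosym t != 0 by rewrite gt_eqF.
  apply: complex_eq; rewrite !(ReM, ImM) ?(ReD, ImD) ?(ReB, ImB) /=.
    by rewrite /cosym in Xn *; field.
  rewrite mul0r !add0r subr0 mul0r addr0 mul1r.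
  have := sin2_cosym t; rewrite /cosym in Xn * => s2.
  transitivity (- 2 * sin t ^+ 2 / (2 + 2 * cos t)); first by field.
  by rewrite s2; field.
transitivity (K * (z * (d * (1 + E)) - 'i * (k + 1)%:~R - 'i * k%:~R * E)); first by ring.
by rewrite dE rmorphD /=; ring.
Qed.

Lemma kprimE z k t : kprim z k t = kern z (k + 1) t * (1 + cexp ('i * t%:C)).
Proof. by rewrite /kprim [kern z k t]kernS; ring. Qed.

Lemma normc_1Dcis t : normc (1 + cexp ('i * t%:C)) ^+ 2 = cosym t.
Proof.
rewrite cexp_i /= sqr_sqrtr ?addr_ge0 ?sqr_ge0//.
by have := cos2Dsin2 t; rewrite /cosym add0r => h; nra.
Qed.

(** The gain of 1/2 over the exponent of the kernel comes from |1 + e^(it)| = X^(1/2); it forces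
    [kprim] to 0 at pi when Re z > -1/2. *)
Lemma normc_kprim z k t : normc (kprim z k t) <= cosym t `^ (complex.Re z + 1 / 2).
Proof.
rewrite kprimE normcM normc_kern.
have [X0|X0] := eqVneq (cosym t) 0.
  have := normc_1Dcis t; rewrite X0 => /eqP; rewrite sqrf_eq0 => /eqP ->.
  by rewrite mulr0 powR_ge0.
have Xp : 0 < cosym t by rewrite lt_neqAle eq_sym X0 cosym_ge0.
have -> : normc (1 + cexp ('i * t%:C)) = expR (1 / 2 * ln (cosym t)).
  apply/eqP; rewrite -(@eqrXn2 _ 2) ?normc_ge0 ?expR_ge0// normc_1Dcis.
  by rewrite -expRM_natl mulrA mul1r divff// mul1r lnK.
by rewrite -expRD -mulrDl /powR (negbTE X0).
Qed.

Lemma powR_cosym_cvg0 b t : 0 < b -> cosym t = 0 ->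
  (fun s => cosym s `^ b) @ t --> (0 : R).
Proof.
move=> b0 X0; apply/cvgrPdist_le => e e0.
have Xc : cosym @ t --> (0 : R).
  rewrite -X0; apply: differentiable_continuous; apply/derivable1_diffP.
  by case: (is_derive_cosym t).
have d0 : 0 < e `^ b^-1 by rewrite powR_gt0.
move/cvgrPdist_le: Xc => /(_ _ d0); apply: filterS => s.
rewrite !sub0r !normrN ger0_norm ?cosym_ge0// ger0_norm ?powR_ge0// => Xs.
rewrite -[e]powRr1 ?(ltW e0)// -(mulVf (lt0r_neq0 b0)) powRrM.
by apply: ge0_ler_powR; rewrite ?nnegrE ?cosym_ge0 ?powR_ge0// ltW.
Qed.

Lemma ccontinuous_squeeze (f : R -> R[i]) (g : R -> R) t : f t = 0 ->
  (forall s, normc (f s) <= g s) -> g @ t --> (0 : R) -> ccontinuous t f.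
Proof.
move=> ft fg g0.
have main (h : R -> R) : (forall s, `|h s| <= normc (f s)) -> h t = 0 -> {for t, continuous h}.
  move=> hf ht; rewrite /prop_for /continuous_at ht.
  apply/cvgrPdist_le => e e0.
  move/cvgrPdist_le : g0 => /(_ e e0); apply: filterS => s.
  rewrite !sub0r !normrN => H; apply: le_trans (hf s) _; apply: le_trans (fg s) _.
  exact: le_trans (ler_norm _) H.
by split; apply: main; rewrite ?ft// => s; [exact: le_Re_normc|exact: le_Im_normc].
Qed.

Lemma kprim_continuous z k t : - (1 / 2) < complex.Re z -> ccontinuous t (kprim z k).
Proof.
move=> z0; have [X0|X0] := eqVneq (cosym t) 0.
  have b0 : 0 < complex.Re z + 1 / 2 by lra.
  apply: (ccontinuous_squeeze _ (normc_kprim z k)); last exact: powR_cosym_cvg0.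
  apply: eq0_normc; apply/eqP; rewrite eq_le normc_ge0 andbT.
  by apply: le_trans (normc_kprim z k t) _; rewrite X0 powR0// gt_eqF.
have Xp : 0 < cosym t by rewrite lt_neqAle eq_sym X0 cosym_ge0.
exact: is_cderive_continuous (is_cderive_kprim z k Xp).
Qed.

(* The function s sin > 0 (s = 1 or -1) controls the singularity at pi:
   X^b <= X^(b - 1/2) s sin + 4^(b + 1), and the first term has an explicit bounded primitive. *)
Lemma integrable_cosym_power (s b u v : R) : u < v -> s ^+ 2 = 1 ->
  (forall t, u < t < v -> 0 < s * sin t) -> - (1 / 2) < b ->
  mu.-integrable `]u, v[ (EFin \o (fun t => expR (b * ln (cosym t)))).
Proof.
move=> uv s2 ss b0.
have X0 t : u < t < v -> 0 < cosym t.
  by move=> /ss h; apply: cosym_gt0; apply: contraTneq h => ->; rewrite mulr0 ltxx.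
have dexp c t : u < t < v -> is_derive t 1 (fun t => expR (c * ln (cosym t)))
    (expR (c * ln (cosym t)) * (c * (- (2 * sin t) / cosym t))).
  move=> /X0 Xt; have dl := is_derive_ln_cosym Xt.
  have dc : is_derive t 1 (fun t => c * ln (cosym t)) (c * (- (2 * sin t) / cosym t)).
    by apply: is_derive_eq; rewrite /GRing.scale /=; ring.
  exact: (@is_derive1_comp _ expR).
have cexp' c t : u < t < v -> {for t, continuous (fun t => expR (c * ln (cosym t)))}.
  move=> /(dexp c)[d _].
  by apply: differentiable_continuous; exact/derivable1_diffP.
pose f t := expR ((b - 1 / 2) * ln (cosym t)) * (s * sin t).
pose F t := - s / (2 * b + 1) * expR ((b + 1 / 2) * ln (cosym t)).
have b1 : 0 < 2 * b + 1 by lra.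
have fi : mu.-integrable `]u, v[ (EFin \o f).
  apply: (@integrable_antiderivative _ f F u v (expR ((b + 1 / 2) * ln 4) / (2 * b + 1)) uv).
  - by move=> t /ss h; rewrite mulr_ge0 ?expR_ge0// ltW.
  - move=> t tuv; apply: cvgM; first exact: cexp'.
    by apply: cvgM; [exact: cvg_cst|exact: continuous_sin].
  - move=> t tuv; have d := dexp (b + 1 / 2) t tuv; have Xt := X0 t tuv.
    apply: is_derive_eq; rewrite /GRing.scale /= /f.
    have -> : (b + 1 / 2) * ln (cosym t) = (b - 1 / 2) * ln (cosym t) + ln (cosym t) by field.
    rewrite expRD lnK//; field.
    by rewrite !gt_eqF.
  - move=> t tuv; have Xt := X0 t tuv.
    rewrite normrM normrM normfV normrN (ger0_norm (expR_ge0 _)) (gtr0_norm b1).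
    have -> : `|s| = 1.
      by apply/eqP; rewrite -(@eqrXn2 _ 2)// -normrX s2 normr1 expr1n.
    rewrite [1 / (2 * b + 1)]mul1r [_ * expR _]mulrC ler_wpM2r ?invr_ge0 ?(ltW b1)// ler_expR ler_wpM2l ?ln_cosym_le4//.
    by lra.
have cc : mu.-integrable `[u, v] (EFin \o (fun=> expR ((b + 1) * ln 4))).
  apply: continuous_compact_integrable; first exact: segment_compact.
  by apply: continuous_subspaceT => t; exact: cvg_cst.
have ci : mu.-integrable `]u, v[ (EFin \o (fun=> expR ((b + 1) * ln 4))).
  by apply: integrableS cc => //; exact: subset_itv_oo_cc.
have mI : measurable (`]u, v[ : set (measurableTypeR R)) by exact: measurable_itv.
apply: le_integrable (RintegrableD mI fi ci); first exact: mI.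
  apply/measurable_EFinP; apply: open_continuous_measurable_fun; first exact: interval_open.
  by move=> x /set_mem /= xuv; apply: cexp'; move: xuv; rewrite in_itv.
move=> t /=; rewrite in_itv /= => tuv; have Xt := X0 t tuv; rewrite lee_fin.
rewrite ger0_norm ?expR_ge0//.
apply: le_trans (ler_norm _).
set L := ln (cosym t).
(* For sig = s sin t / X^(1/2) in [0, 1], 1 - sig <= 1 - sig^2 = X/4, so X^b (1 - sig) is at most
   X^(b+1). *)
have sig2 : (s * sin t * expR (- (1 / 2) * L)) ^+ 2 = 1 - cosym t / 4.
  rewrite !exprMn s2 sin2_cosym -expRM_natl.
  have -> : 2 * (- (1 / 2) * L) = - L by field.
  by rewrite expRN /L lnK// mul1r mulrAC divff ?mul1r// gt_eqF.
have sig0 : 0 <= s * sin t * expR (- (1 / 2) * L) by rewrite mulr_ge0 ?expR_ge0// ltW// ss.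
set sig := s * sin t * _ in sig2 sig0.
have sig1 : sig <= 1 by have := cosym_ge0 t; nra.
have -> : f t = expR (b * L) * sig.
  by rewrite /f /sig -/L mulrBl expRD -mulNr; ring.
have h1 : expR ((b + 1) * L) <= expR ((b + 1) * ln 4).
  by rewrite ler_expR ler_wpM2l ?ln_cosym_le4//; lra.
have h2 : expR ((b + 1) * L) = expR (b * L) * cosym t.
  by rewrite mulrDl mul1r expRD lnK.
apply: le_trans (lerD (lexx _) h1); rewrite h2 -mulrDr ler_peMr ?expR_ge0//.
have := cosym_ge0 t; nra.
Qed.

End Kernel.

(** * Integrals of the kernel over the punctured circle *)

Section KernelIntegral.
Variable R : realType.
Local Notation mu := (@lebesgue_measure R).
Implicit Types (t s b : R) (z w : R[i]) (k : int) (f g : R -> R[i]).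
Local Open Scope classical_set_scope.

(** Two open intervals on which sin has a constant sign, adjacent to the singular point pi. *)
Definition punctured t := (0 < t < pi) || (pi < t < 2 * pi).

Definition cintO f := cint `]0, pi[ f + cint `]pi, (2 * pi)[ f.

Definition cintegrableO f :=
  cintegrable `]0, (pi : R)[ f /\ cintegrable `]pi, (2 * pi)[ f.

Lemma pi_lt_2pi : pi < 2 * pi :> R.
Proof. by have := pi_gt0 R; lra. Qed.

Lemma measurable_oo (u v : R) : measurable (`]u, v[ : set (measurableTypeR R)).
Proof. exact: measurable_itv. Qed.

Lemma sin_right t : 0 < t < pi -> 0 < 1 * sin t.
Proof. by rewrite mul1r; exact: sin_gt0_pi. Qed.

Lemma sin_left t : pi < t < 2 * pi -> 0 < -1 * sin t.
Proof.
move=> /andP[t1 t2]; rewrite mulN1r.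
have -> : - sin t = sin (t - pi) by rewrite sinB cospi sinpi; ring.
by apply: sin_gt0_pi; apply/andP; split; lra.
Qed.

Lemma cosym_punctured t : punctured t -> 0 < cosym t.
Proof.
move=> /orP[/sin_right|/sin_left] h; apply: cosym_gt0; apply: contraTneq h => ->;
by rewrite mulr0 ltxx.
Qed.

Lemma integrable_cosym_halves b : - (1 / 2) < b ->
  mu.-integrable `]0, pi[ (EFin \o (fun t => expR (b * ln (cosym t)))) /\
  mu.-integrable `]pi, (2 * pi)[ (EFin \o (fun t => expR (b * ln (cosym t)))).
Proof.
move=> b0; split.
  by apply: (@integrable_cosym_power R 1 b) => //; [exact: pi_gt0|exact: expr1n|exact: sin_right].
apply: (@integrable_cosym_power R (-1) b) => //; [exact: pi_lt_2pi| |exact: sin_left].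
by rewrite sqrrN expr1n.
Qed.

Lemma kern_integrable z k : - (1 / 2) < complex.Re z -> cintegrableO (kern z k).
Proof.
move=> z0; have [i1 i2] := integrable_cosym_halves z0.
split; [apply: (cintegrable_oo _ _ i1)|apply: (cintegrable_oo _ _ i2)] => t tI.
- by apply: kern_continuous; apply: cosym_punctured; rewrite /punctured tI.
- by rewrite normc_kern.
- by apply: kern_continuous; apply: cosym_punctured; rewrite /punctured tI orbT.
- by rewrite normc_kern.
Qed.

Lemma cintegrableOD f g : cintegrableO f -> cintegrableO g ->
  cintegrableO (fun t => f t + g t).
Proof.
by move=> [f1 f2] [g1 g2]; split; apply: cintegrableD => //; exact: measurable_oo.
Qed.

Lemma cintegrableOZ w f : cintegrableO f -> cintegrableO (fun t => w * f t).
Proof. by move=> [f1 f2]; split; apply: cintegrableZ => //; exact: measurable_oo. Qed.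

Lemma cintOD f g : cintegrableO f -> cintegrableO g ->
  cintO (fun t => f t + g t) = cintO f + cintO g.
Proof.
move=> [f1 f2] [g1 g2]; rewrite /cintO !cintD//; try exact: measurable_oo.
by rewrite addrACA.
Qed.

Lemma cintOZ w f : cintegrableO f -> cintO (fun t => w * f t) = w * cintO f.
Proof.
move=> [f1 f2]; rewrite /cintO (cintZ w (measurable_oo _ _) f1) (cintZ w (measurable_oo _ _) f2).
by rewrite [RHS]mulrDr.
Qed.

Lemma eq_cintO f g : (forall t, punctured t -> f t = g t) -> cintO f = cintO g.
Proof.
move=> fg; congr (_ + _); apply: eq_cint => t /=; rewrite in_itv /= => tI; apply: fg.
  by rewrite /punctured tI.
by rewrite /punctured tI orbT.
Qed.

Lemma cexp_i_int k t : cexp ('i * t%:C) = 1 -> cexp ('i * k%:~R * t%:C) = 1 :> R[i].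
Proof.
move=> e1; have en n : cexp ('i * n%:R * t%:C) = 1.
  have -> : 'i * n%:R * t%:C = n%:R * ('i * t%:C) by ring.
  by rewrite cexpMn e1 expr1n.
case: (intP k) => [|n|n]; first exact: (en 0%N).
  exact: (en n.+1).
rewrite rmorphN /= mulrN mulNr cexpN.
by have := en n.+1 => ->; rewrite invr1.
Qed.

Lemma kprim_period z k : kprim z k (2 * pi) = kprim z k 0.
Proof.
have p2 : 2 * pi = pi *+ 2 :> R by rewrite mulr_natl.
have X : cosym (2 * pi : R) = cosym 0 by rewrite /cosym p2 cos2pi cos0.
have e1 : cexp ('i * (2 * pi)%:C) = 1 :> R[i].
  by rewrite cexp_i p2 cos2pi sin2pi.
have P j : kern z j (2 * pi) = kern z j 0.
  rewrite /kern X !cexpB (cexp_i_int _ e1).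
  by rewrite [(0 : R)%:C]/(0 : R[i]) mulr0 cexp0.
by rewrite /kprim !P.
Qed.

Lemma kprim'_integrable z k : - (1 / 2) < complex.Re z -> cintegrableO (kprim' z k).
Proof.
by move=> z0; apply: cintegrableOD; apply: cintegrableOZ; exact: kern_integrable.
Qed.

Lemma kprim'_continuous z k t : 0 < cosym t -> ccontinuous t (kprim' z k).
Proof.
move=> X0.
have d1 := is_cderiveM (is_cderive_cst t ('i * (z - k%:~R))) (is_cderive_kern z k X0).
have d2 := is_cderiveM (is_cderive_cst t (- ('i * (z + 1 + k%:~R))))
  (is_cderive_kern z (k + 1) X0).
exact: is_cderive_continuous (is_cderiveD d1 d2).
Qed.

Definition kint z k := cintO (kern z k).

Lemma kint_rec z k : - (1 / 2) < complex.Re z ->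
  (z + 1 + k%:~R) * kint z (k + 1) = (z - k%:~R) * kint z k.
Proof.
move=> z0; have [i1 i2] := kprim'_integrable k z0.
have : cintO (kprim' z k) = 0.
  rewrite /cintO (@cint_improper _ _ (kprim z k) _ _ (pi_gt0 R) i1); last first.
  - by move=> t tI; apply: is_cderive_kprim; apply: cosym_punctured; rewrite /punctured tI.
  - by move=> t tI; apply: kprim'_continuous; apply: cosym_punctured; rewrite /punctured tI.
  - by move=> t _; exact: kprim_continuous.
  rewrite (@cint_improper _ _ (kprim z k) _ _ pi_lt_2pi i2); last first.
  - by move=> t tI; apply: is_cderive_kprim; apply: cosym_punctured; rewrite /punctured tI orbT.
  - by move=> t tI; apply: kprim'_continuous; apply: cosym_punctured; rewrite /punctured tI orbT.
  - by move=> t _; exact: kprim_continuous.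
  (* The values at pi from the two halves cancel, and those at 0 and 2 pi agree by periodicity. *)
  by rewrite kprim_period addrC subrKA subrr.
have j1 := kern_integrable k z0; have j2 := kern_integrable (k + 1) z0.
rewrite /kprim' cintOD; [|exact: cintegrableOZ|exact: cintegrableOZ].
rewrite !cintOZ// -/(kint z k) -/(kint z (k + 1)) => h.
apply: (mulfI (neq0Ci R[i])); apply: subr0_eq; rewrite -[RHS]oppr0 -h; ring.
Qed.

Lemma kern_mul_cosym z t : 0 < cosym t ->
  kern (z + 1) 0 t = 2 * kern z 0 t + kern z 1 t + kern z (-1) t.
Proof.
move=> X0; have e1 : kern z (-1) t = kern z 0 t * cexp ('i * t%:C).
  by rewrite kernS addNr.
have e2 : kern z 1 t = kern z 0 t * cexp (- ('i * t%:C)).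
  by rewrite [kern z 0 t]kernS add0r -mulrA -cexpD subrr cexp0 mulr1.
have e3 : kern (z + 1) 0 t = kern z 0 t * (cosym t)%:C.
  rewrite -[in RHS](lnK X0) -cexp_real /kern -cexpD; congr cexp; ring.
rewrite e1 e2 e3; have -> : (cosym t)%:C = 2 + cexp (- ('i * t%:C)) + cexp ('i * t%:C).
  have -> : - ('i * t%:C) = 'i * (- t)%:C :> R[i] by rewrite rmorphN mulrN.
  rewrite !cexp_i cosN sinN; apply: complex_eq; rewrite !(ReD, ImD) /= /cosym; ring.
by ring.
Qed.

(** Write X^(z+1) as X^z (2 + e^(it) + e^(-it)); the recurrence at k = 0 and k = -1 expresses the
    two neighbouring coefficients through the central one. *)
Lemma kint_shift z : - (1 / 2) < complex.Re z ->
  (z + 1) * kint (z + 1) 0 = 2 * (2 * z + 1) * kint z 0.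
Proof.
move=> z0; have j k := kern_integrable k z0.
have -> : kint (z + 1) 0 = 2 * kint z 0 + kint z 1 + kint z (-1).
  rewrite /kint -cintOZ// -!cintOD//.
  - by apply: eq_cintO => t /cosym_punctured; exact: kern_mul_cosym.
  - by apply: cintegrableOD => //; exact: cintegrableOZ.
  - exact: cintegrableOZ.
have := kint_rec 0 z0; have := kint_rec (-1) z0.
rewrite addNr add0r !(addr0, subr0) rmorphN opprK /= addrK => e1 e2.
transitivity (2 * (z + 1) * kint z 0 + (z + 1) * kint z 1 + (z + 1) * kint z (-1)).
  by ring.
by rewrite e2 -e1; ring.
Qed.

Lemma kint0 : kint 0 0 = (2 * pi)%:C.
Proof.
have e (u v : R) : u <= v -> cint `]u, v[ (kern 0 0) = (v - u)%:C.
  move=> uv; rewrite (@eq_cint _ _ _ (fun=> 1)); last first.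
    by move=> t _; rewrite /kern mul0r mulr0 mul0r subrr cexp0.
  have mE : fine (mu `]u, v[) = v - u.
    rewrite lebesgue_measure_itv /= lte_fin.
    move: uv; rewrite le_eqVlt => /predU1P[->|->]; last by rewrite -EFinB.
    by rewrite ltxx subrr.
  apply: complex_eq; rewrite /= (Rintegral_cst _ (measurable_oo _ _)) ?mul0r// mul1r.
  exact: mE.
have p0 := pi_gt0 R; have p2 := pi_lt_2pi.
rewrite /kint /cintO !e ?ltW// -rmorphD /=; congr _%:C; lra.
Qed.

(** The binomial coefficient of 2n over n, as the product of its successive ratios; 2 pi times it is
    the integral of X^n. *)
Definition central n : R := \prod_(m < n) (2 * (2 * m%:R + 1) / m.+1%:R).

Lemma central_gt0 n : 0 < central n.
Proof.
apply: prodr_gt0 => m _; by rewrite divr_gt0// mulr_gt0.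
Qed.

Lemma centralS n :
  (central n.+1)%:C = (central n)%:C * (2 * (2 * n%:R + 1) / n.+1%:R) :> R[i].
Proof.
by rewrite /central big_ord_recr /= !(rmorphM, rmorphD, fmorphV, rmorph1, rmorph_nat).
Qed.

Lemma kint_addn z n : - (1 / 2) < complex.Re z -> no_neg_int z ->
  kint (z + n%:R) 0 =
  kint z 0 * (central n)%:C * (gamma_prod (2 * z) n.*2 / gamma_prod z n ^+ 2).
Proof.
move=> z0 zn; elim: n => [|n IH].
  by rewrite addr0 /central /gamma_prod !big_ord0 expr1n divr1 !mulr1.
have Re_n : complex.Re (z + n%:R) = complex.Re z + n%:R.
  by rewrite ReD -natr_complex.
have zn0 : - (1 / 2) < complex.Re (z + n%:R).
  by rewrite Re_n; have : 0 <= n%:R :> R by []; lra.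
have n0 : z + n.+1%:R != 0.
  have := zn n; apply: contraNneq => /eqP; rewrite addr_eq0 => /eqP ->.
  by rewrite mulNr divff ?subrr ?natrS_neq0.
have := kint_shift zn0; rewrite -addrA natr1 => h.
apply: (mulfI n0); rewrite h IH doubleS !gamma_prodS double_factor centralS.
move: (zn n) n0 (gamma_prod_neq0 n zn) (natrS_neq0 R n) (natrS_neq0 R n.*2).
rewrite -[n.*2.+1%:R]natr1 -muln2 natrM muln2 -[n.+1%:R]natr1.
move: (gamma_prod z n) (gamma_prod _ _) (kint z 0) ((central n)%:C) => p q I0 c.
move: (n%:R) => x zx zx' p0 x1 x2.
have xz : x + 1 + z != 0 by rewrite addrC.
by field; rewrite p0 x1 x2 xz.
Qed.

End KernelIntegral.

(** * The zeroth coefficient, from the concentration of X^n dt at X = 4 *)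

Section CentralCoefficient.
Variable R : realType.
Local Notation mu := (@lebesgue_measure R).
Implicit Types (t s b : R) (z w : R[i]) (f g : R -> R[i]).
Local Open Scope classical_set_scope.

(** With s = ln (4/X) >= 0, compare e^(-sz) - 1 with |z| (e^s - 1): the derivatives compare because
    -Re z < 1. This form of the bound, multiplied by X^(n+1), becomes X^n (4 - X), whose integral is
    explicit. *)
Lemma normc_cpower_diff z t : - (1 / 2) < complex.Re z -> 0 < cosym t ->
  normc (cexp (z * (ln (cosym t))%:C) - cexp (z * (ln 4)%:C)) <=
  normc z * expR (complex.Re z * ln 4) * ((4 - cosym t) / cosym t).
Proof.
move=> z0 X0; set s := ln 4 - ln (cosym t).
have s0 : 0 <= s by rewrite subr_ge0 ln_cosym_le4.
have -> : cexp (z * (ln (cosym t))%:C) = cexp (z * (ln 4)%:C) * cexp (s%:C * - z).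
  by rewrite -cexpD; congr cexp; rewrite /s rmorphB /=; ring.
have -> : forall u v : R[i], u * v - u = u * (v - 1) by move=> u v; ring.
rewrite normcM normc_cexp.
have -> : complex.Re (z * (ln 4)%:C) = complex.Re z * ln 4 by rewrite ReM /= mulr0 subr0.
rewrite -mulrA mulrCA ler_wpM2l ?expR_ge0//.
have -> : normc z * ((4 - cosym t) / cosym t) = normc z * (expR s - 1).
  by rewrite expRB !lnK ?posrE//; field; rewrite gt_eqF.
have := @cderive_bound _ (fun x => cexp (x%:C * - z) - 1) (fun x => - z * cexp (x%:C * - z))
  (fun x => normc z * (expR x - 1)) (fun x => normc z * expR x) s s0.
apply => [x|x|x /andP[x0 _]|].
- have := is_cderiveD (is_cderive_cexp_scale (- z) x) (is_cderive_cst x (-1)).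
  by rewrite addr0.
- by apply: is_derive_eq; rewrite /GRing.scale /=; ring.
- rewrite normcM normcN normc_cexp Re_scale ReN ler_wpM2l ?normc_ge0// ler_expR; nra.
- by rewrite mul0r cexp0 expR0 !subrr normc0 mulr0.
Qed.

Lemma normc_cintO_le f g : cintegrableO f -> cintegrableO g ->
  (forall t, punctured t -> normc (f t) <= complex.Re (g t)) ->
  normc (cintO f) <= complex.Re (cintO g).
Proof.
move=> [f1 f2] [[g1 _] [g2 _]] fg; rewrite /cintO ReD.
apply: le_trans (le_normcD _ _) _; apply: lerD.
  apply: normc_cint_le g1 _ => [|//|t]; first exact: measurable_oo.
  by rewrite /= in_itv /= => tI; apply: fg; rewrite /punctured tI.
apply: normc_cint_le g2 _ => [|//|t]; first exact: measurable_oo.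
by rewrite /= in_itv /= => tI; apply: fg; rewrite /punctured tI orbT.
Qed.

Lemma kern_addn z n t :
  kern (z + n%:R) 0 t = cexp (z * (ln (cosym t))%:C) * (expR (n%:R * ln (cosym t)))%:C.
Proof.
rewrite -cexp_real /kern -cexpD; congr cexp.
by rewrite rmorphM /= rmorph_nat; ring.
Qed.

Lemma kern_nat n t : kern n%:R 0 t = (expR (n%:R * ln (cosym t)))%:C.
Proof. by rewrite -[n%:R]add0r kern_addn mul0r cexp0 mul1r. Qed.

Lemma Re_natr n : complex.Re (n%:R : R[i]) = n%:R.
Proof. by rewrite -natr_complex. Qed.

Lemma kint_nat n : kint n%:R 0 = (2 * pi * central R n)%:C.
Proof.
have g1 m : gamma_prod (0 : R[i]) m = 1 by apply: big1 => i _; rewrite mul0r addr0.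
have z0 : no_neg_int (0 : R[i]) by move=> m; rewrite mul0r addr0 oner_eq0.
have r0 : - (1 / 2) < complex.Re (0 : R[i]) by rewrite /=; lra.
rewrite -[n%:R]add0r (kint_addn n r0 z0).
by rewrite kint0 mulr0 !g1 expr1n divr1 mulr1 -rmorphM.
Qed.

Lemma kint_close z n : - (1 / 2) < complex.Re z ->
  normc (kint (z + n.+1%:R) 0 - cexp (z * (ln 4)%:C) * kint n.+1%:R 0) <=
  normc z * expR (complex.Re z * ln 4) * (2 * pi * (4 * central R n - central R n.+1)).
Proof.
move=> z0; set K := normc z * _; set w := cexp _.
have nr m : - (1 / 2) < complex.Re (m%:R : R[i]).
  by rewrite Re_natr; apply: (@lt_le_trans _ _ 0) => //; lra.
have zr : - (1 / 2) < complex.Re (z + n.+1%:R).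
  by rewrite ReD Re_natr; have : 0 <= n.+1%:R :> R by []; lra.
have i1 := kern_integrable 0 zr; have i2 := kern_integrable 0 (nr n.+1).
have i3 := kern_integrable 0 (nr n).
have -> : kint (z + n.+1%:R) 0 - w * kint n.+1%:R 0 =
    cintO (fun t => kern (z + n.+1%:R) 0 t + - w * kern n.+1%:R 0 t).
  by rewrite cintOD ?cintOZ ?mulNr//; exact: cintegrableOZ.
have e4 := cintegrableOZ (4 : R[i]) i3; have e1 := cintegrableOZ (-1 : R[i]) i2.
have e := cintegrableOD e4 e1.
have -> : K * (2 * pi * (4 * central R n - central R n.+1)) =
    complex.Re (cintO (fun t => K%:C * (4 * kern n%:R 0 t + -1 * kern n.+1%:R 0 t))).
  rewrite cintOZ// cintOD// !cintOZ// -/(kint _ _) -/(kint _ _) !kint_nat.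
  have -> : 4 = 4%:C :> R[i] by rewrite rmorph_nat.
  rewrite mulN1r -rmorphM -rmorphB -rmorphM /=; ring.
apply: normc_cintO_le; [|exact: cintegrableOZ|].
  by apply: cintegrableOD => //; exact: cintegrableOZ.
move=> t /cosym_punctured X0; rewrite kern_addn !kern_nat.
have -> : forall u v x : R[i], u * x + - v * x = (u - v) * x by move=> u v x; ring.
rewrite normcM normc_real ger0_norm ?expR_ge0//.
have -> : 4 = 4%:C :> R[i] by rewrite rmorph_nat.
rewrite mulN1r -rmorphM -rmorphB -rmorphM /=.
have h : expR (n.+1%:R * ln (cosym t)) = expR (n%:R * ln (cosym t)) * cosym t.
  by rewrite -natr1 mulrDl mul1r expRD lnK.
apply: (@le_trans _ _ (K * ((4 - cosym t) / cosym t) * expR (n.+1%:R * ln (cosym t)))).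
  by rewrite ler_wpM2r ?expR_ge0//; exact: normc_cpower_diff.
rewrite h le_eqVlt; apply/orP; left; apply/eqP; field.
by rewrite gt_eqF.
Qed.

(** The mass of X^n (4 - X) is that of X^(n+1) divided by 2n + 1: this is the quantitative
    concentration at X = 4. *)
Lemma central_diff n :
  4 * central R n - central R n.+1 = central R n.+1 / (2 * n%:R + 1).
Proof.
rewrite /central big_ord_recr /= -/(central R n).
have x0 : 0 <= n%:R :> R by [].
rewrite -[n.+1%:R]natr1; move: (n%:R) x0 => x x0; field.
by rewrite !gt_eqF//; lra.
Qed.

Lemma central_coef_cvg z : - (1 / 2) < complex.Re z -> no_neg_int z ->
  (fun n => kint z 0 / (2 * pi)%:C * gamma_prod (2 * z) n.*2 / gamma_prod z n ^+ 2 : R[i]^o)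
    @ \oo --> (cexp ((ln 2)%:C * (2 * z)) : R[i]^o).
Proof.
move=> z0 zn.
pose u n : R[i]^o := kint z 0 / (2 * pi)%:C * gamma_prod (2 * z) n.*2 / gamma_prod z n ^+ 2.
rewrite -[X in X @ \oo]/u -(cvg_shiftS u).
apply: (@cvgc_squeeze _ _ _ (fun n => normc z * expR (complex.Re z * ln 4) * n.+1%:R^-1));
  last exact: cvg_mul_harmonic.
apply: nearW => n.
have C0 := central_gt0 R n.+1; have p0 := pi_gt0 R.
have P0 : 0 < 2 * pi * central R n.+1 by rewrite !mulr_gt0.
have pc : (pi : R)%:C != 0 :> R[i] by rewrite eq_complex /= negb_and gt_eqF.
have := kint_close n z0; rewrite kint_addn// kint_nat central_diff.
have -> : cexp (z * (ln 4)%:C) = cexp ((ln 2)%:C * (2 * z)).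
  have -> : 4 = 2 * 2 :> R by rewrite -natrM.
  by rewrite lnM ?posrE// rmorphD /=; congr cexp; ring.
set w := cexp _; set K := normc z * _.
have -> : kint z 0 * (central R n.+1)%:C * (gamma_prod (2 * z) n.+1.*2 / gamma_prod z n.+1 ^+ 2) -
   w * (2 * pi * central R n.+1)%:C = - ((2 * pi * central R n.+1)%:C * (w - u n.+1)).
  rewrite /u [(2 * pi * _)%:C]rmorphM /=.
  have := gamma_prod_neq0 n.+1 zn.
  move: (gamma_prod z _) (gamma_prod (2 * z) _) (kint z 0) => p q I0 p0'.
  by move: (pi : R) pc => y pc; field; rewrite pc p0'.
rewrite normcN normc_scale gtr0_norm// => H.
rewrite -(ler_pM2l P0); apply: le_trans H _.
have K0 : 0 <= K by rewrite mulr_ge0 ?normc_ge0 ?expR_ge0.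
have -> : K * (2 * pi * (central R n.+1 / (2 * n%:R + 1))) =
  2 * pi * central R n.+1 * (K * (2 * n%:R + 1)^-1) by ring.
rewrite ler_wpM2l ?(ltW P0)// ler_wpM2l// lef_pV2 ?posrE//.
by rewrite -natr1; have : 0 <= n%:R :> R by []; lra.
Qed.

Lemma no_neg_int_Re z : -1 < complex.Re z -> no_neg_int z.
Proof.
move=> z1 n; apply/eqP => h.
have : complex.Re (1 + z / n.+1%:R) = 0 by rewrite h.
rewrite ReD -invn_complex mulrC Re_scale /= => /eqP.
have n1 : n.+1%:R^-1 <= 1 :> R by rewrite invf_le1 ?ler1n.
have n0 : 0 < n.+1%:R^-1 :> R by rewrite invr_gt0.
have z2 : 0 < complex.Re z + 1 by lra.
have := mulr_gt0 n0 z2; rewrite mulrDr mulr1 => h1.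
apply/negP; rewrite gt_eqF//; apply: lt_le_trans h1 _.
by rewrite addrC lerD2r.
Qed.

(** At t = pi the symbol takes the value of [cpow] at 0, which may differ from [kern]; the
    integrands are compared on the open halves only, and the remaining points are null. *)
Lemma fourier_coef_kint (alpha : R[i]) (phi : R[i] -> R[i]) (k : int) :
  - (1 / 2) < complex.Re alpha ->
  (forall t : R, phi (cis t) = u_symbol alpha (cis (t - pi))) ->
  fourier_coef phi k = (1 / (2 * pi))%:C * kint alpha k.
Proof.
move=> a0 phiE; congr (_ * _); rewrite /cintegral.
pose f (t : R) := phi (cis t) * cexp (- ('i * k%:~R * t%:C)).
have fk t : punctured t -> f t = kern alpha k t.
  move=> /cosym_punctured X0; rewrite /f phiE u_symbol_cisBpi -/(cosym t).
  by rewrite cpowE// /kern cexpB cexpN.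
have fR t : 0 < t < pi -> f t = kern alpha k t.
  by move=> h; apply: fk; rewrite /punctured h.
have fL t : pi < t < 2 * pi -> f t = kern alpha k t.
  by move=> h; apply: fk; rewrite /punctured h orbT.
have [[i1 j1] [i2 j2]] := kern_integrable k a0.
have p1 := pi_gt0 R; have p2 := pi_lt_2pi R.
have E (P : R[i] -> R) :
  mu.-integrable `]0, pi[ (EFin \o (fun t => P (kern alpha k t))) ->
  mu.-integrable `]pi, (2 * pi)[ (EFin \o (fun t => P (kern alpha k t))) ->
  (\int[mu]_(t in `[0%R, (2 * pi)%R]) P (f t))%R =
  (\int[mu]_(t in `]0%R, pi[) P (kern alpha k t))%R +
  (\int[mu]_(t in `]pi, (2 * pi)%R[) P (kern alpha k t))%R.
  move=> h1 h2; rewrite (integrable_itv_cat (f := fun t => P (f t)) p1 p2).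
  - congr (_ + _); apply: eq_Rintegral => t; rewrite inE /= in_itv /= => tI.
      by rewrite fR.
    by rewrite fL.
  - apply: eq_integrable h1; first exact: measurable_oo.
    by move=> t; rewrite inE /= in_itv /= => tI; rewrite fR.
  - apply: eq_integrable h2; first exact: measurable_oo.
    by move=> t; rewrite inE /= in_itv /= => tI; rewrite fL.
by rewrite /kint /cintO /cint; apply: complex_eq; rewrite /= ?ReD ?ImD /= E.
Qed.

End CentralCoefficient.

Theorem theorem7p8 (R : realType) (alpha : R[i]) (phi : R[i] -> R[i])
  (alpha_nonint : forall m : int, alpha <> m%:~R)
  (alpha_gt : - (1 / 2) < complex.Re alpha)
  (phiE : forall t : R, phi (cis t) = u_symbol alpha (cis (t - pi))) :
  asymp_equiv
    (fun n : nat => \det (toeplitz_hankel phi n))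
    (fun n : nat =>
       cpow n%:R ((alpha ^+ 2 + alpha) / 2) *
       cpow (2 * pi) (- (alpha / 2)) *
       cpow 2 (3 * alpha ^+ 2 / 2) *
       (barnesG (1 / 2 + alpha) * barnesG (1 + alpha) ^+ 2 /
        (barnesG (1 / 2) * barnesG (1 + 2 * alpha)))).
Proof.
have half : 1 / 2 = (1 / 2 : R)%:C :> R[i] by rewrite rmorphM rmorph1 fmorphV rmorph_nat.
(* The four arguments z of G(1 + z) have real part > -1; for 2 alpha and alpha - 1/2 this is the
   bound Re alpha > -1/2 itself. *)
have a1 : no_neg_int alpha by apply: no_neg_int_Re; lra.
have a2 : no_neg_int (2 * alpha).
  by apply: no_neg_int_Re; rewrite mulr_natl mulr2n ReD; lra.
have a3 : no_neg_int (alpha - 1 / 2).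
  by apply: no_neg_int_Re; rewrite ReB half /=; lra.
have a4 : no_neg_int (- (1 / 2) : R[i]).
  by apply: no_neg_int_Re; rewrite ReN half /=; lra.
have phik k := fourier_coef_kint k alpha_gt phiE.
pose psi (k : int) := fourier_coef phi k.
have psi_rec (k : int) :
    (alpha + 1 + k%:~R) * psi (k + 1) = (alpha - k%:~R) * psi k.
  by rewrite /psi !phik mulrCA kint_rec// mulrCA.
have nonint (m : int) : alpha + m%:~R != 0.
  by apply/eqP => /eqP; rewrite addr_eq0 -rmorphN => /eqP; exact: alpha_nonint.
have npos m : 2 * alpha + m.+1%:R != 0.
  apply/eqP => h; have : complex.Re (2 * alpha + m.+1%:R) = 0 by rewrite h.
  rewrite ReD mulr_natl mulr2n ReD Re_natr -natr1.
  have : 0 <= m%:R :> R by [].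
  by move=> m0 /eqP; apply/negP; rewrite gt_eqF//; lra.
have c0 : psi 0 = kint alpha 0 / (2 * pi)%:C.
  by rewrite /psi phik rmorphM rmorph1 fmorphV mul1r mulrC.
have cc := central_coef_cvg alpha_gt a1; rewrite -c0 in cc.
have D n : \det (toeplitz_hankel phi n) =
    gamma_ratio (psi 0) alpha n.*2 ^+ n * barnes_ratio alpha n.
  by rewrite -(prod_gamma_barnes a1 a2 a3 a4) -(det_toeplitz_hankel nonint npos psi_rec).
have -> : (fun n => \det (toeplitz_hankel phi n)) =
    (fun n => gamma_ratio (psi 0) alpha n.*2 ^+ n * barnes_ratio alpha n).
  by apply/funext => n; exact: D.
exact: asymp_equiv_barnes a1 a2 a3 a4 cc.
Qed.
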